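(* Let $\Phi$ be irreducible with highest root $\gamma$ and $\mathfrak h_\gamma=\Phi^+\setminus\{\gamma\}$. There exist $\mathbb R[\Delta]$-module homomorphisms (divided difference operators) $\partial^\gamma_i:H_T^*(\mathfrak h_\gamma)\to H_T^*(\mathfrak h_\gamma)$, $i=1,\dots,k$, and a family $\{\mathcal P^w\}_{w\in W}$ where each $\mathcal P^w$ is a flow-up class at $w$, such that for every $w\in W$ and every $i$, $$\partial^\gamma_i\mathcal P^w=\begin{cases}\mathcal P^{s_iw}&\text{if } s_iw<w,\\ 0&\text{if } s_iw>w.\end{cases}$$ Further, if $w=s_{i_1}\cdots s_{i_n}=s_{j_1}\cdots s_{j_n}$ are two reduced expressions for $w\in W$, then $\partial^\gamma_{i_1}\cdots\partial^\gamma_{i_n}=\partial^\gamma_{j_1}\cdots\partial^\gamma_{j_n}$; so $\partial_w:=\partial^\gamma_{i_1}\cdots\partial^\gamma_{i_n}$ is well defined.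
   Context: $\Phi$ is a crystallographic root system in a finite-dimensional real Euclidean space with base $\Delta=\{\alpha_1,\dots,\alpha_k\}$, positive roots $\Phi^+$, $\Phi^-=-\Phi^+$, Weyl group $W$ generated by the simple reflections $s_i=s_{\alpha_i}$ ($s_\alpha$ the reflection through $\alpha$), acting on $\mathbb R[\Delta]=\mathbb R[\alpha_1,\dots,\alpha_k]$. $\Phi$ irreducible means it is not a disjoint union of two root systems; then there is a unique highest root $\gamma\in\Phi^+$ with $\alpha\prec\gamma$ for all $\alpha\in\Phi$, where $\alpha\prec\beta$ means $\beta-\alpha$ is a sum of positive roots. Bruhat order $<$ on $W$ is the transitive closure of $u<s_\alpha u$ for $\alpha\in\Phi^+$ with $(s_\alpha u)^{-1}\alpha\in\Phi^-$. The Hessenberg graph $\Gamma_{\mathfrak h_\gamma}$ has vertex set $W$ and a directed edge $u\to w$ whenever $w=s_\alpha u$, $\alpha\in\Phi^+$, $w^{-1}\alpha\in-\mathfrak h_\gamma$. The GKM ring $H_T^*(\mathfrak h_\gamma)$ is the ring (and $\mathbb R[\Delta]$-module) of maps $\mathcal P:W\to\mathbb R[\Delta]$ with $\mathcal P(w)-\mathcal P(s_\alpha w)\in\langle\alpha\rangle$ for each edge of $\Gamma_{\mathfrak h_\gamma}$ joining $w$ and $s_\alpha w$; $\mathcal P\in H^d_T$ if every nonzero value is homogeneous of degree $d$. Write $x<_\gamma y$ if there is a directed path from $x$ to $y$ in $\Gamma_{\mathfrak h_\gamma}$, and let $\ell_\gamma(x)$ be the number of edges of $\Gamma_{\mathfrak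 h_\gamma}$ ending at $x$. A flow-up class at $x$ is $\mathcal P\in H_T^{\ell_\gamma(x)}(\mathfrak h_\gamma)$ with $\mathcal P(x)=\prod\alpha$ over the edges $s_\alpha x\to x$ of $\Gamma_{\mathfrak h_\gamma}$, and $\mathcal P(y)\neq0$ only if $y=x$ or $x<_\gamma y$. *)

(* Defs.v *)
From HB Require Import structures.
From mathcomp Require Import all_boot all_order all_algebra.
From mathcomp Require Import reals.
From mathcomp Require Import mpoly.

Set Implicit Arguments.
Unset Strict Implicit.
Unset Printing Implicit Defensive.

Import Order.TTheory GRing.Theory Num.Theory.
Local Open Scope ring_scope.

Section RootData.
Variables (R : realType) (n k : nat).

Definition vec := 'cV[R]_n.

Definition dot (u v : vec) : R := (u^T *m v) 0 0.

(* Reflection s_alpha : v |-> v - (2 (alpha,v)/(alpha,alpha)) alpha, as a matrix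
   acting on column vectors (composition = matrix product). *)
Definition refl (alpha : vec) : 'M[R]_n :=
  1%:M - (2 / dot alpha alpha) *: (alpha *m alpha^T).

Definition root_system (Phi : seq vec) : Prop :=
  [/\ 0 \notin Phi,
      (forall v : vec, exists c : 'I_(size Phi) -> R,
          v = \sum_(i < size Phi) c i *: Phi`_i),
      (forall alpha (c : R), alpha \in Phi -> c *: alpha \in Phi ->
          c = 1 \/ c = -1),
      (forall alpha beta, alpha \in Phi -> beta \in Phi ->
          refl alpha *m beta \in Phi) &
      (forall alpha beta, alpha \in Phi -> beta \in Phi ->
          exists z : int, 2 * dot beta alpha / dot alpha alpha = z%:~R)].

(* Irreducible: Phi cannot be split into two nonempty mutually orthogonal
   parts (i.e. it is not the disjoint union of two root systems). *)
Definition irreducible (Phi : seq vec) : Prop :=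
  forall S : vec -> Prop,
    (forall x y, x \in Phi -> y \in Phi -> S x -> ~ S y -> dot x y = 0) ->
    (forall x, x \in Phi -> S x) \/ (forall x, x \in Phi -> ~ S x).

Definition base (Phi : seq vec) (a : 'I_k -> vec) : Prop :=
  [/\ (forall i, a i \in Phi),
      (forall c : 'I_k -> R, \sum_i c i *: a i = 0 -> forall i, c i = 0) &
      (forall beta, beta \in Phi -> exists c : 'I_k -> nat,
          beta = \sum_i (c i)%:R *: a i \/ beta = - \sum_i (c i)%:R *: a i)].

Definition pos (Phi : seq vec) (a : 'I_k -> vec) (beta : vec) : Prop :=
  beta \in Phi /\ exists c : 'I_k -> nat, beta = \sum_i (c i)%:R *: a i.

Definition prec (Phi : seq vec) (a : 'I_k -> vec) (alpha beta : vec) : Prop :=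
  exists s : seq vec, (forall x, x \in s -> pos Phi a x) /\
                      beta - alpha = \sum_(x <- s) x.

Definition highest_root (Phi : seq vec) (a : 'I_k -> vec) (gamma : vec) : Prop :=
  gamma \in Phi /\ forall alpha, alpha \in Phi -> prec Phi a alpha gamma.

Definition word_mx (a : 'I_k -> vec) (s : seq 'I_k) : 'M[R]_n :=
  foldr (fun i M => refl (a i) *m M) 1%:M s.

Definition inW (a : 'I_k -> vec) (w : 'M[R]_n) : Prop :=
  exists s : seq 'I_k, w = word_mx a s.

Definition reduced_word (a : 'I_k -> vec) (s : seq 'I_k) (w : 'M[R]_n) : Prop :=
  w = word_mx a s /\ forall t, w = word_mx a t -> (size s <= size t)%N.

Definition bruhat_step (Phi : seq vec) (a : 'I_k -> vec) (u v : 'M[R]_n) : Prop :=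
  inW a u /\ exists alpha, pos Phi a alpha /\ v = refl alpha *m u /\
                           pos Phi a (- (invmx v *m alpha)).

Inductive bruhat_lt (Phi : seq vec) (a : 'I_k -> vec) : 'M[R]_n -> 'M[R]_n -> Prop :=
  | bruhat_lt1 u v : bruhat_step Phi a u v -> bruhat_lt Phi a u v
  | bruhat_lt_trans u v w : bruhat_lt Phi a u v -> bruhat_lt Phi a v w ->
                            bruhat_lt Phi a u w.

Definition h_gamma (Phi : seq vec) (a : 'I_k -> vec) (gamma : vec) (beta : vec) : Prop :=
  pos Phi a beta /\ beta <> gamma.

Definition hess_edge (Phi : seq vec) (a : 'I_k -> vec) (h : vec -> Prop)
    (alpha : vec) (u w : 'M[R]_n) : Prop :=
  [/\ inW a u, pos Phi a alpha, w = refl alpha *m u & h (- (invmx w *m alpha))].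

Inductive hess_lt (Phi : seq vec) (a : 'I_k -> vec) (h : vec -> Prop) :
    'M[R]_n -> 'M[R]_n -> Prop :=
  | hess_lt1 alpha u w : hess_edge Phi a h alpha u w -> hess_lt Phi a h u w
  | hess_lt_trans u v w : hess_lt Phi a h u v -> hess_lt Phi a h v w ->
                          hess_lt Phi a h u w.

(* R[Delta]: since Delta is a basis of R^n, R[Delta] is the polynomial ring
   on R^n; a vector v is identified with the linear form x |-> (v, x). *)
Definition poly := {mpoly R[n]}.

Definition linpoly (v : vec) : poly := \sum_(j < n) v j 0 *: 'X_j.

(* Classes: maps W -> R[Delta] (values off W are irrelevant). *)
Definition cls := 'M[R]_n -> poly.

Definition eqW (a : 'I_k -> vec) (P Q : cls) : Prop :=
  forall w, inW a w -> P w = Q w.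

Definition gkm (Phi : seq vec) (a : 'I_k -> vec) (h : vec -> Prop) (P : cls) : Prop :=
  forall alpha u w, hess_edge Phi a h alpha u w ->
    exists q : poly, P u - P w = linpoly alpha * q.

(* P in H^d_T: every value (on W) is homogeneous of degree d (0 included). *)
Definition homdeg (a : 'I_k -> vec) (d : nat) (P : cls) : Prop :=
  forall w, inW a w -> P w \is d.-homog.

(* Flow-up class at x. The in-edges s_alpha x -> x are indexed by their
   labels alpha, listed without repetition in s; l_h(x) = size s. *)
Definition flowup (Phi : seq vec) (a : 'I_k -> vec) (h : vec -> Prop)
    (x : 'M[R]_n) (P : cls) : Prop :=
  gkm Phi a h P /\
  exists s : seq vec,
    [/\ uniq s,
        (forall alpha, alpha \in s <-> exists u, hess_edge Phi a h alpha u x),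
        homdeg a (size s) P,
        P x = \prod_(alpha <- s) linpoly alpha &
        (forall y, inW a y -> P y <> 0 -> y = x \/ hess_lt Phi a h x y)].

(* R[Delta]-module endomorphism of H_T^*(h) (maps on classes, respecting
   equality on W). *)
Definition gkm_hom (Phi : seq vec) (a : 'I_k -> vec) (h : vec -> Prop)
    (D : cls -> cls) : Prop :=
  [/\ (forall P Q, gkm Phi a h P -> gkm Phi a h Q -> eqW a P Q -> eqW a (D P) (D Q)),
      (forall P, gkm Phi a h P -> gkm Phi a h (D P)) &
      (forall (f g : poly) P Q, gkm Phi a h P -> gkm Phi a h Q ->
         eqW a (D (fun w => f * P w + g * Q w))
               (fun w => f * D P w + g * D Q w))].

Definition comp_ops (D : 'I_k -> cls -> cls) (s : seq 'I_k) (P : cls) : cls :=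
  foldr (fun i Q => D i Q) P s.

End RootData.

(* Main.v *)
(* The graph of h_gamma is the full Bruhat graph without the edges between w and
   w s_gamma, i.e. those labelled by +-(w gamma), and gamma is dominant.  Start
   from the equivariant Schubert classes of the full Bruhat graph, obtained from
   classes supported at one point by left divided differences.  Along an upward
   Bruhat edge the vector w gamma decreases, so if w gamma < 0 the Schubert class of
   w vanishes at all y with y gamma > 0; it is therefore divisible by y gamma at
   every y, and the quotient is the flow-up class at w.  If w gamma > 0 the Schubert
   class of w, corrected by a multiple of the flow-up class at w s_gamma when the
   length goes up by one, is a flow-up class.  Flow-up classes form a basis of
   the GKM module, so the operators may be prescribed on this basis, and the
   result of a composition on it depends only on lengths and on the product. *)
Require Import Defs.
From HB Require Import structures.
From mathcomp Require Import all_boot all_order all_algebra.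
From mathcomp Require Import boolp reals.
From mathcomp Require Import mpoly.
From mathcomp Require Import ring zify.
Set Implicit Arguments.
Unset Strict Implicit.
Unset Printing Implicit Defensive.

Import Order.TTheory GRing.Theory Num.Theory.
Local Open Scope ring_scope.

(** Substituting these forms for the variables extends [v |-> M *m v] from linear forms to a ring
    endomorphism; for [M] in [W] this is the action of [M] on R[Delta]. *)
Definition linpoly_cols {R : realType} {n : nat} (M : 'M[R]_n) :
  n.-tuple {mpoly R[n]} := [tuple linpoly (col j M) | j < n].

Notation act M := (comp_mpoly (linpoly_cols M)).

(** * Divisibility by linear forms *)

Section LinearForms.
Context {R : realType} {n : nat}.
Implicit Types (u v : 'cV[R]_n) (p q : {mpoly R[n]}) (M : 'M[R]_n).

Lemma linpolyD u v : linpoly (u + v) = linpoly u + linpoly v.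
Proof.
rewrite /linpoly -big_split; apply: eq_bigr => j _.
by rewrite mxE scalerDl.
Qed.

Lemma linpolyZ c v : linpoly (c *: v) = c *: linpoly v.
Proof.
rewrite /linpoly scaler_sumr; apply: eq_bigr => j _.
by rewrite mxE scalerA.
Qed.

Lemma linpoly0 : linpoly (0 : 'cV[R]_n) = 0.
Proof. by rewrite -(scale0r (0 : 'cV[R]_n)) linpolyZ scale0r. Qed.

Lemma linpolyN v : linpoly (- v) = - linpoly v.
Proof. by rewrite -scaleN1r linpolyZ scaleN1r. Qed.

Lemma linpolyB u v : linpoly (u - v) = linpoly u - linpoly v.
Proof. by rewrite linpolyD linpolyN. Qed.

Lemma linpoly_eq0 v : (linpoly v == 0) = (v == 0).
Proof.
apply/eqP/eqP => [v0|->]; last exact: linpoly0.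
apply/matrixP => j l; rewrite ord1 mxE.
have := congr1 (mcoeff U_(j)) v0.
rewrite /linpoly mcoeff0 raddf_sum (bigD1 j) //= mcoeffZ mcoeffXU eqxx mulr1.
rewrite big1 ?addr0 // => i ij; by rewrite mcoeffZ mcoeffXU (negbTE ij) mulr0.
Qed.

Lemma linpoly_neq0 {v} : v != 0 -> linpoly v != 0.
Proof. by rewrite linpoly_eq0. Qed.

Lemma linpoly_homog v : linpoly v \is 1.-homog.
Proof.
apply: rpred_sum => j _; apply: dhomogZ.
by rewrite dhomogX /= mdeg1.
Qed.

Lemma act_linpoly M v : act M (linpoly v) = linpoly (M *m v).
Proof.
rewrite [in LHS]/linpoly rmorph_sum /=.
have -> : M *m v = \sum_j v j 0 *: col j M.
  apply/matrixP => i l; rewrite ord1 mxE summxE.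
  by apply: eq_bigr => j _; rewrite !mxE mulrC.
have -> : linpoly (\sum_j v j 0 *: col j M) = \sum_j linpoly (v j 0 *: col j M).
  apply: (big_morph (@linpoly R n)); [exact: linpolyD|exact: linpoly0].
apply: eq_bigr => j _.
by rewrite comp_mpolyZ comp_mpolyXU -tnth_nth tnth_mktuple linpolyZ.
Qed.

Lemma act_homog M p d : p \is d.-homog -> act M p \is d.-homog.
Proof.
move=> /dhomogP ph; rewrite comp_mpolyEX.
apply: rpred_sum => m _.
case: (boolP (m \in msupp p)) => [mp|]; last first.
  by move/memN_msupp_eq0 => ->; rewrite scale0r dhomog0.
apply: dhomogZ; rewrite -(ph m mp) /= mdegE comp_mpolyX.
apply: (big_ind2 (fun (q : {mpoly R[n]}) e => q \is e.-homog)).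
- exact: dhomog1.
- by move=> *; apply: dhomogM.
move=> i _; rewrite tnth_mktuple -[X in X.-homog]mul1n.
by apply: dhomogMn; exact: linpoly_homog.
Qed.

Definition ldvd v p := exists q, p = linpoly v * q.

Lemma ldvd0 v : ldvd v 0.
Proof. by exists 0; rewrite mulr0. Qed.

Lemma ldvdD v p q : ldvd v p -> ldvd v q -> ldvd v (p + q).
Proof. by move=> [p' ->] [q' ->]; exists (p' + q'); rewrite mulrDr. Qed.

Lemma ldvdMl v p q : ldvd v p -> ldvd v (q * p).
Proof. by move=> [p' ->]; exists (q * p'); rewrite mulrCA. Qed.

Lemma ldvdMr v p q : ldvd v p -> ldvd v (p * q).
Proof. by rewrite mulrC; apply: ldvdMl. Qed.

Lemma ldvdN v p : ldvd v p -> ldvd v (- p).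
Proof. by rewrite -mulN1r; apply: ldvdMl. Qed.

Lemma ldvdB v p q : ldvd v p -> ldvd v q -> ldvd v (p - q).
Proof. by move=> vp /ldvdN; apply: ldvdD. Qed.

Lemma ldvd_act M v p : ldvd v p -> ldvd (M *m v) (act M p).
Proof. by move=> [q ->]; exists (act M q); rewrite rmorphM /= act_linpoly. Qed.

Lemma mul_rank1 v u : v *m v^T *m u = dot v u *: v.
Proof.
by rewrite -mulmxA [v^T *m u]mx11_scalar mul_mx_scalar.
Qed.

(** The polynomials with this property include constants and variables and are closed under sums and
    products. The scalar [c] is left free to cover both reflections and orthogonal projections. *)
Lemma ldvd_sub_act c v p : ldvd v (p - act (1%:M - c *: (v *m v^T)) p).
Proof.
set M := 1%:M - _.
have XM j : ldvd v ('X_j - act M 'X_j).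
  rewrite comp_mpolyXU -tnth_nth tnth_mktuple.
  have -> : col j M = delta_mx j 0 - (c * v j 0) *: v.
    apply/matrixP => i l; rewrite !mxE !ord1 big_ord1 !mxE eqxx andbT.
    by move: (v i 0) (v j 0) => x y; ring.
  have -> : 'X_j = linpoly (delta_mx j 0 : 'cV[R]_n).
    rewrite /linpoly (bigD1 j) //= mxE !eqxx scale1r big1 ?addr0 // => i ij.
    by rewrite mxE (negbTE ij) scale0r.
  rewrite linpolyB opprB addrC subrK linpolyZ.
  by exists (c * v j 0)%:MP; rewrite -mul_mpolyC mulrC.
pose S q := ldvd v (q - act M q).
have SM q r : S q -> S r -> S (q * r).
  rewrite /S rmorphM /= => Sq Sr.
  have -> : q * r - act M q * act M r = (q - act M q) * r + act M q * (r - act M r).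
    by rewrite mulrBl mulrBr addrA subrK.
  by apply: ldvdD; [apply: ldvdMr|apply: ldvdMl].
have SC a : S a%:MP by rewrite /S comp_mpolyC subrr; exact: ldvd0.
move: p; apply: mpolyind => [|a m p _ _ IH].
  by rewrite rmorph0 subr0; exact: ldvd0.
have -> : a *: 'X_[m] + p - act M (a *: 'X_[m] + p)
  = (a *: 'X_[m] - act M (a *: 'X_[m])) + (p - act M p) by rewrite rmorphD opprD addrACA.
apply: ldvdD; last exact: IH.
rewrite -mul_mpolyC; apply: (SM); first exact: (SC).
have S1 : S 1 by rewrite -mpolyC1; exact: SC.
rewrite mpolyXE_id; apply: (big_ind S) => [||i _]; [exact: S1|exact: SM|].
elim: (m i) => [|e IHe]; first by rewrite expr0; exact: S1.
by rewrite exprS; apply: (SM); [exact: XM|exact: IHe].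
Qed.

Lemma dot_gt0 v : v != 0 -> 0 < dot v v.
Proof.
move=> v0; rewrite /dot mxE.
have [i vi] : exists i, v i 0 != 0.
  apply/existsP; apply: contraNT v0; rewrite negb_exists => /forallP v0.
  by apply/eqP/matrixP => i j; rewrite ord1 mxE; apply/eqP; have := v0 i; rewrite negbK.
rewrite (bigD1 i) //= mxE; apply: ltr_pwDl.
  by rewrite -expr2 exprn_even_gt0.
by apply: sumr_ge0 => j _; rewrite mxE -expr2 sqr_ge0.
Qed.

Definition perp_proj v : 'M[R]_n := 1%:M - (dot v v)^-1 *: (v *m v^T).

(* [p] is a multiple of [linpoly v] iff it vanishes on the hyperplane
   orthogonal to [v], and restricting to the hyperplane is a ring morphism. *)
Lemma ldvd_proj v p : v != 0 -> ldvd v p <-> act (perp_proj v) p = 0.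
Proof.
move=> v0; split=> [[q ->]|p0].
  rewrite rmorphM /= act_linpoly mulmxBl mul1mx -scalemxAl mul_rank1 scalerA.
  by rewrite mulVf ?gt_eqF ?dot_gt0 // scale1r subrr linpoly0 mul0r.
by rewrite -[p]subr0 -p0; exact: ldvd_sub_act.
Qed.

(** Restriction to the hyperplane lands in an integral domain, so a vanishing product has a
    vanishing factor. *)
Lemma ldvd_prime v p q : v != 0 -> ldvd v (p * q) -> ldvd v p \/ ldvd v q.
Proof.
move=> v0 /(ldvd_proj _ v0); rewrite rmorphM /= => /eqP.
by rewrite mulf_eq0 => /orP[] /eqP H; [left|right]; apply/(ldvd_proj _ v0).
Qed.

Lemma ldvd_linpoly v u : v != 0 -> ldvd v (linpoly u) -> exists c, u = c *: v.
Proof.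
move=> v0 /(ldvd_proj _ v0); rewrite act_linpoly => /eqP; rewrite linpoly_eq0.
rewrite mulmxBl mul1mx -scalemxAl mul_rank1 scalerA subr_eq0 => /eqP uv.
by exists ((dot v v)^-1 * dot v u).
Qed.

(** Pairwise non-proportional linear forms are non-associate primes, so they can be divided out one
    at a time. *)
Lemma prod_linpoly_dvd (s : seq 'cV[R]_n) p :
  uniq s -> 0 \notin s ->
  {in s &, forall u v, u <> v -> forall c, u <> c *: v} ->
  {in s, forall v, ldvd v p} ->
  exists q, p = (\prod_(v <- s) linpoly v) * q.
Proof.
elim: s p => [|v s IH] p /=.
  by move=> _ _ _ _; exists p; rewrite big_nil mul1r.
move=> /andP[vs us]; rewrite inE negb_or eq_sym => /andP[v0 s0] ind dv.
have ind_s : {in s &, forall u w, u <> w -> forall c, u <> c *: w}.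
  by move=> u w us' ws; apply: ind; rewrite inE ?us' ?ws orbT.
have dv_s : {in s, forall u, ldvd u p}.
  by move=> u us'; apply: dv; rewrite inE us' orbT.
have [q pq] := IH p us s0 ind_s dv_s.
have : ldvd v p by apply: dv; rewrite mem_head.
rewrite pq => /ldvd_prime [] // [].
(* By primality [v] would divide a form of the remaining list, which would then be proportional to
   it. *)
- move=> r; have : ldvd v (\prod_(u <- s) linpoly u) -> False.
    have : {in s, forall u, ~ ldvd v (linpoly u)}.
      move=> u us' /ldvd_linpoly [] // c; apply: ind; rewrite ?mem_head ?inE ?us' ?orbT //.
      by move=> uv; rewrite -uv us' in vs.
    elim: (s) => [|u t IHt] ht.
      rewrite big_nil => /(ldvd_proj _ v0); rewrite rmorph1 => /eqP.
      by rewrite oner_eq0.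
    rewrite big_cons => /ldvd_prime [] //; first by apply: ht; rewrite mem_head.
    by apply: IHt => w wt; apply: ht; rewrite inE wt orbT.
  by move=> H rE; case: H; exists r.
- by move=> r ->; exists r; rewrite big_cons mulrCA mulrA.
Qed.

Lemma prod_linpoly_homog (s : seq 'cV[R]_n) :
  \prod_(v <- s) linpoly v \is (size s).-homog.
Proof.
elim: s => [|v s IH]; first by rewrite big_nil dhomog1.
rewrite big_cons /= -(add1n (size s)).
by apply: dhomogM; [exact: linpoly_homog|exact: IH].
Qed.

Lemma prod_linpoly_neq0 (s : seq 'cV[R]_n) :
  0 \notin s -> \prod_(v <- s) linpoly v != 0.
Proof.
elim: s => [|v s IH]; first by rewrite big_nil oner_eq0.
rewrite inE negb_or eq_sym big_cons => /andP[v0 s0].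
by rewrite mulf_neq0 ?linpoly_neq0 ?IH.
Qed.

(** The component of [p * q] in degree [e + j] is [p] times the component of [q] in degree [j]; in a
    domain only [j] with [e + j = d] survives. *)
Lemma dhomog_div p q d e :
  p \is e.-homog -> p * q \is d.-homog -> p * q != 0 ->
  (e <= d)%N /\ q \is (d - e).-homog.
Proof.
move=> pe pqd; rewrite mulf_eq0 negb_or => /andP[p0 q0].
have qE := pihomog_partitionE (mf := @mdeg n) (leqnn (msize q)).
have key j : (j < msize q)%N -> (e + j)%N != d -> pihomog mdeg j q = 0.
  move=> jq ejd; apply/eqP; move: (p0); apply: contraNT => qj.
  have : pihomog mdeg (e + j) (p * q) = p * pihomog mdeg j q.
    rewrite {1}qE mulr_sumr raddf_sum (bigD1 (Ordinal jq)) //= big1 ?addr0.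
      by apply: pihomog_dE; apply: dhomogM => //; exact: pihomogP.
    move=> i ij; apply: (@pihomog_ne0 _ _ _ (e + i)%N).
      by rewrite eqn_add2l; exact: ij.
    by apply: dhomogM => //; exact: pihomogP.
  rewrite (@pihomog_ne0 _ _ _ d) // 1?eq_sym // => /esym/eqP.
  by rewrite mulf_eq0 (negbTE qj) orbF eq_sym.
have ed : (e <= d)%N.
  rewrite leqNgt; apply: contra q0 => de; rewrite qE big1 // => i _.
  by apply: key => //; rewrite gtn_eqF // (leq_trans de) // leq_addr.
split => //; rewrite qE; apply: rpred_sum => i _.
have [<-|H] := eqVneq (e + i)%N d; first by rewrite addKn pihomogP.
by rewrite (key i) // dhomog0.
Qed.

End LinearForms.

(** * Roots, lengths and the Bruhat order *)

Section Reflections.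
Context {R : realType} {n : nat}.
Implicit Types (u v al : 'cV[R]_n) (M : 'M[R]_n) (p : {mpoly R[n]}).

Lemma mulmx_ext (M N : 'M[R]_n) : (forall v : 'cV[R]_n, M *m v = N *m v) -> M = N.
Proof.
move=> MN; apply/matrixP => i j.
have := congr1 (fun v : 'cV[R]_n => v i 0) (MN (delta_mx j 0)).
by rewrite -!colE !mxE.
Qed.

Lemma dotC u v : dot u v = dot v u.
Proof. by rewrite /dot -[u^T *m v]trmxK trmx_mul trmxK mxE. Qed.

Lemma dotZr u c v : dot u (c *: v) = c * dot u v.
Proof. by rewrite /dot -scalemxAr mxE. Qed.

Lemma dot_sumr u (I : Type) (r : seq I) (F : I -> 'cV[R]_n) :
  dot u (\sum_(i <- r) F i) = \sum_(i <- r) dot u (F i).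
Proof. by rewrite /dot mulmx_sumr summxE. Qed.

Lemma dot_mul M u v : dot u (M *m v) = dot (M^T *m u) v.
Proof. by rewrite /dot trmx_mul trmxK mulmxA. Qed.

Lemma refl_mul al v : refl al *m v = v - (2 / dot al al * dot al v) *: al.
Proof. by rewrite mulmxBl mul1mx -scalemxAl mul_rank1 scalerA. Qed.

Lemma refl_tr al : (refl al)^T = refl al.
Proof. by rewrite /refl linearB /= trmx1 linearZ /= trmx_mul trmxK. Qed.

Lemma refl_self al : al != 0 -> refl al *m al = - al.
Proof.
move=> al0; rewrite refl_mul mulfVK ?gt_eqF ?dot_gt0 //.
by rewrite scalerDl scale1r opprD addrA subrr sub0r.
Qed.

Lemma refl_sqr al : al != 0 -> refl al *m refl al = 1%:M.
Proof.
move=> al0; apply: mulmx_ext => v; rewrite -mulmxA mul1mx [refl al *m v]refl_mul.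
rewrite mulmxBr -scalemxAr refl_self // refl_mul scalerN opprK.
by rewrite subrK.
Qed.

Lemma reflK al v : al != 0 -> refl al *m (refl al *m v) = v.
Proof. by move=> al0; rewrite mulmxA refl_sqr // mul1mx. Qed.

Lemma reflKm al M : al != 0 -> refl al *m (refl al *m M) = M.
Proof. by move=> al0; rewrite mulmxA refl_sqr // mul1mx. Qed.

Lemma refl_conj M al : M *m M^T = 1%:M ->
  refl (M *m al) = M *m refl al *m M^T.
Proof.
move=> MMT; have MTM : M^T *m M = 1%:M by apply: mulmx1C.
rewrite /refl mulmxBr mulmxBl mulmx1 MMT; congr (_ - _).
rewrite -scalemxAr -scalemxAl -!mulmxA; congr (_ / _ *: _).
  by rewrite [LHS]dot_mul mulmxA MTM mul1mx.
by rewrite trmx_mul.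
Qed.

Lemma reflN al : refl (- al) = refl al.
Proof.
have E : (- al)^T = - al^T by apply/matrixP => i j; rewrite !mxE.
by rewrite /refl /dot E !mulNmx !mulmxN !opprK.
Qed.

Lemma act_refl_sub al p : ldvd al (p - act (refl al) p).
Proof. exact: ldvd_sub_act. Qed.

Lemma act_mul M (N : 'M[R]_n) p : act M (act N p) = act (M *m N) p.
Proof.
rewrite (comp_mpolyEX p (linpoly_cols N)) (comp_mpolyEX p (linpoly_cols (M *m N))).
rewrite rmorph_sum; apply: eq_bigr => m _ /=; rewrite comp_mpolyZ; congr (_ *: _).
rewrite !comp_mpolyX rmorph_prod; apply: eq_bigr => i _.
by rewrite rmorphXn /= !tnth_mktuple act_linpoly !colE mulmxA.
Qed.

Lemma act1 p : act (1%:M : 'M[R]_n) p = p.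
Proof.
rewrite -[RHS]comp_mpoly_id; congr (_ \mPo _); apply: eq_from_tnth => j.
rewrite !tnth_mktuple /linpoly (bigD1 j) //= !mxE eqxx scale1r big1 ?addr0 //.
by move=> i ij; rewrite !mxE (negbTE ij) scale0r.
Qed.

Lemma act_reflK al p : al != 0 -> act (refl al) (act (refl al) p) = p.
Proof. by move=> al0; rewrite act_mul refl_sqr // act1. Qed.

End Reflections.

(** * Positive roots and the cone spanned by the base *)

Section HighestRoot.
Context {R : realType} {n k : nat}.
Variables (Phi : seq 'cV[R]_n) (a : 'I_k -> 'cV[R]_n) (gamma : 'cV[R]_n).
Hypotheses (rootsP : root_system Phi) (baseP : base Phi a).
Hypothesis highP : highest_root Phi a gamma.
Implicit Types (u v w y : 'M[R]_n) (al be : 'cV[R]_n) (i : 'I_k) (F P : cls R n).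

Local Notation s_ i := (refl (a i)).

Lemma root_neq0 al : al \in Phi -> al != 0.
Proof. by case: rootsP => n0 _ _ _ _ al_in; apply: contraNneq n0 => <-. Qed.

Lemma root_refl al be : al \in Phi -> be \in Phi -> refl al *m be \in Phi.
Proof. by case: rootsP => _ _ _ + _; apply. Qed.

Lemma rootN al : al \in Phi -> - al \in Phi.
Proof. by move=> al_in; rewrite -(refl_self (root_neq0 al_in)) root_refl. Qed.

Lemma root_prop al c be : al \in Phi -> be \in Phi -> al = c *: be ->
  al = be \/ al = - be.
Proof.
move=> al_in be_in alE; case: rootsP => _ _ /(_ be c be_in) + _ _.
by rewrite -alE => /(_ al_in) [] c1; move: alE; rewrite c1 ?scale1r ?scaleN1r; [left|right].
Qed.

Lemma simple_root i : a i \in Phi.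
Proof. by case: baseP. Qed.

Lemma simple_neq0 i : a i != 0.
Proof. exact: root_neq0 (simple_root i). Qed.

Lemma base_inj (c d : 'I_k -> R) :
  \sum_i c i *: a i = \sum_i d i *: a i -> c =1 d.
Proof.
move=> /eqP; rewrite -subr_eq0 -sumrB => /eqP cd i; apply/eqP; rewrite -subr_eq0.
apply/eqP; case: baseP => _ + _ => /(_ (fun i => c i - d i)); apply.
by rewrite -[RHS]cd; apply: eq_bigr => j _; rewrite scalerBl.
Qed.

(** Real coefficients, unlike the natural ones in [pos], allow scaling by nonnegative reals; a root
    in this cone is positive. *)
Definition nonneg be := exists2 c : 'I_k -> R,
  (forall i, 0 <= c i) & be = \sum_i c i *: a i.

Lemma nonnegD be al : nonneg be -> nonneg al -> nonneg (be + al).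
Proof.
move=> [c c0 ->] [d d0 ->]; exists (fun i => c i + d i) => [i|].
  by rewrite addr_ge0.
by rewrite -big_split; apply: eq_bigr => i _; rewrite scalerDl.
Qed.

Lemma nonnegZ c be : 0 <= c -> nonneg be -> nonneg (c *: be).
Proof.
move=> c0 [d d0 ->]; exists (fun i => c * d i) => [i|]; first by rewrite mulr_ge0.
by rewrite scaler_sumr; apply: eq_bigr => i _; rewrite scalerA.
Qed.

Lemma nonneg0 : nonneg 0.
Proof.
by exists (fun=> 0) => //; rewrite big1 // => i _; rewrite scale0r.
Qed.

Lemma nonneg_anti be : nonneg be -> nonneg (- be) -> be = 0.
Proof.
move=> [c c0 bE] [d d0 /eqP]; rewrite eqr_oppLR => /eqP bE'.
have cd : c =1 fun i => - d i.
  apply: base_inj; rewrite -bE bE' -sumrN.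
  by apply: eq_bigr => i _; rewrite scaleNr.
rewrite bE big1 // => i _; suff -> : c i = 0 by rewrite scale0r.
by apply/eqP; rewrite eq_le c0 cd oppr_le0 d0.
Qed.

Lemma pos_nonneg be : pos Phi a be -> nonneg be.
Proof. by move=> [_ [c ->]]; exists (fun i => (c i)%:R). Qed.

Lemma pos_root be : pos Phi a be -> be \in Phi.
Proof. by case. Qed.

Lemma pos_or be : be \in Phi -> pos Phi a be \/ pos Phi a (- be).
Proof.
move=> be_in; case: baseP => _ _ /(_ be be_in) [c [bE|bE]]; [left|right].
  by split=> //; exists c.
by split; [exact: rootN|exists c; rewrite bE opprK].
Qed.

Lemma posN be : pos Phi a be -> ~ pos Phi a (- be).
Proof.
move=> bp bn; have := root_neq0 (pos_root bp).
by rewrite (nonneg_anti (pos_nonneg bp) (pos_nonneg bn)) eqxx.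
Qed.

Lemma nonneg_pos be : be \in Phi -> nonneg be -> pos Phi a be.
Proof.
move=> be_in b0; case: (pos_or be_in) => // bn.
have := root_neq0 be_in.
by rewrite (nonneg_anti b0 (pos_nonneg bn)) eqxx.
Qed.

Lemma simple_pos i : pos Phi a (a i).
Proof.
apply: nonneg_pos (simple_root i) _.
exists (fun j => (j == i)%:R) => [j|]; first by rewrite ler0n.
rewrite (bigD1 i) //= eqxx scale1r big1 ?addr0 // => j ji.
by rewrite (negbTE ji) scale0r.
Qed.

(** The reflection changes only the coordinate along [a i], and a positive root other than [a i] has
    another positive coordinate, which rules out a negative image. *)
Lemma simple_refl_pos i be : pos Phi a be -> be <> a i -> pos Phi a (s_ i *m be).
Proof.
move=> bp bi; have sb_in := root_refl (simple_root i) (pos_root bp).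
case: (pos_or sb_in) => // /pos_nonneg [d d0 dE].
have [c c0 bE] := pos_nonneg bp.
have [j ji cj] : exists2 j, j != i & 0 < c j.
  apply: contrapT => H; case: (@root_prop be (c i) (a i) (pos_root bp) (simple_root i)) => //.
    rewrite {1}bE (bigD1 i) //= big1 ?addr0 // => j ji.
    suff -> : c j = 0 by rewrite scale0r.
    apply/eqP; rewrite eq_le c0 andbT leNgt; apply/negP => cj; apply: H.
    by exists j.
  by move=> bE'; case: (posN (simple_pos i)); rewrite -bE'.
pose e := 2 / dot (a i) (a i) * dot (a i) be.
have /base_inj/(_ j) : \sum_l (c l - (l == i)%:R * e) *: a l = \sum_l (- d l) *: a l.
  transitivity (s_ i *m be).
    rewrite refl_mul {1}bE -/e (bigD1 i) //= eqxx mul1r scalerBl [in RHS](bigD1 i) //=.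
    rewrite addrAC; congr (_ + _ - _); apply: eq_bigr => l li.
    by rewrite (negbTE li) mul0r subr0.
  rewrite -[LHS]opprK dE -sumrN; apply: eq_bigr => l _; by rewrite scaleNr.
rewrite (negbTE ji) mul0r subr0 => cE.
by have := d0 j; rewrite -oppr_le0 -cE leNgt cj.
Qed.

(** * The Weyl group as a group of orthogonal matrices *)

Local Notation W := (inW a).

Lemma inW1 : W 1%:M.
Proof. by exists [::]. Qed.

Lemma inW_simple i w : W w -> W (s_ i *m w).
Proof. by move=> [s ->]; exists (i :: s). Qed.

Lemma inW_ind (Q : 'M[R]_n -> Prop) : Q 1%:M ->
  (forall i w, W w -> Q w -> Q (s_ i *m w)) -> forall w, W w -> Q w.
Proof.
move=> Q1 Qs w [s ->]; elim: s => //= i s IH.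
by apply: Qs => //; exists s.
Qed.

Lemma inW_mul u w : W u -> W w -> W (u *m w).
Proof.
move=> + Ww; move: u; apply: inW_ind => [|i u _ IH]; first by rewrite mul1mx.
by rewrite -mulmxA; apply: inW_simple.
Qed.

Lemma inW_tr w : W w -> W w^T.
Proof.
move: w; apply: inW_ind => [|i w _ IH]; first by rewrite trmx1; exact: inW1.
rewrite trmx_mul refl_tr; apply: inW_mul => //.
by rewrite -[s_ i]mulmx1; apply: inW_simple; exact: inW1.
Qed.

Lemma inW_trmul w : W w -> w^T *m w = 1%:M.
Proof.
move: w; apply: inW_ind => [|i w _ IH]; first by rewrite trmx1 mulmx1.
by rewrite trmx_mul refl_tr -mulmxA reflKm ?simple_neq0.
Qed.

Lemma inW_multr w : W w -> w *m w^T = 1%:M.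
Proof. by move=> /inW_trmul; apply: mulmx1C. Qed.

Lemma inW_trK w (x : 'cV[R]_n) : W w -> w^T *m (w *m x) = x.
Proof. by move=> /inW_trmul H; rewrite mulmxA H mul1mx. Qed.

Lemma inW_Ktr w (x : 'cV[R]_n) : W w -> w *m (w^T *m x) = x.
Proof. by move=> /inW_multr H; rewrite mulmxA H mul1mx. Qed.

Lemma inW_inv w : W w -> invmx w = w^T.
Proof.
move=> Ww; have [_ wU] := mulmx1_unit (inW_trmul Ww).
by rewrite -[LHS]mul1mx -(inW_trmul Ww) mulmxK.
Qed.

Lemma inW_root w be : W w -> be \in Phi -> w *m be \in Phi.
Proof.
move=> + be_in; move: w; apply: inW_ind => [|i w _ IH]; first by rewrite mul1mx.
by rewrite -mulmxA root_refl ?simple_root.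
Qed.

Lemma inW_root_tr w be : W w -> be \in Phi -> w^T *m be \in Phi.
Proof. by move=> /inW_tr; apply: inW_root. Qed.

(* Every positive root is conjugate to a simple one, by induction on its height. *)
Lemma inW_refl al : al \in Phi -> W (refl al).
Proof.
suff posW N (c : 'I_k -> nat) be : (\sum_i c i < N)%N -> be \in Phi ->
    be = \sum_i (c i)%:R *: a i -> W (refl be).
  move=> /pos_or [] [al_in [c cE]]; first by apply: posW cE.
  by rewrite -reflN; apply: posW cE.
elim: N c be => // N IH c be cN be_in bE.
have W1 j : W (s_ j) by rewrite -[s_ j]mulmx1; exact/inW_simple/inW1.
have [[j ->]|nsimple] := pselect (exists j, be = a j); first exact: W1.
(* Otherwise expanding [be] over the base would give [dot be be <= 0]. *)
have [i bi] : exists i, 0 < dot be (a i).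
  apply: contrapT => H; have := dot_gt0 (root_neq0 be_in).
  rewrite {2}bE dot_sumr ltNge => /negP; apply; apply: sumr_le0 => i _.
  rewrite dotZr mulr_ge0_le0 // leNgt; apply/negP => bi; apply: H; by exists i.
have bp : pos Phi a be by split=> //; exists c.
have bna : be <> a i by move=> bE'; apply: nsimple; exists i.
have [sb_in [d dE]] := simple_refl_pos bp bna.
pose e := 2 / dot (a i) (a i) * dot (a i) be.
have e0 : 0 < e.
  by rewrite mulr_gt0 // ?divr_gt0 ?dot_gt0 ?simple_neq0 // dotC.
(* The coefficient at [i] drops by [e > 0] and the others stay, so the height strictly decreases. *)
have cd : (fun l => (d l)%:R) =1 (fun l => (c l)%:R - (l == i)%:R * e :> R).
  apply: base_inj; rewrite -dE refl_mul -/e {1}bE [in LHS](bigD1 i) //= [in RHS](bigD1 i) //=.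
  rewrite eqxx mul1r scalerBl [in RHS]addrAC; congr (_ + _ - _); apply: eq_bigr => l li.
  by rewrite (negbTE li) mul0r subr0.
have -> : be = s_ i *m (s_ i *m be) by rewrite reflK ?simple_neq0.
rewrite refl_conj ?refl_tr ?refl_sqr ?simple_neq0 //.
apply: inW_mul (W1 i); apply: inW_mul (W1 i) _.
rewrite ltnS in cN; apply: (IH d) dE => //; apply: leq_trans cN.
rewrite (bigD1 i) //= [X in (_ < X)%N](bigD1 i) //= -addSn leq_add //.
  rewrite -(ltr_nat R) cd eqxx mul1r ltrBlDr ltrDl //.
apply: leq_sum => l li; rewrite -(ler_nat R) cd (negbTE li) mul0r subr0 //.
Qed.

(** * Inversions, length and Bruhat chains *)

Lemma pos_act be u : W u -> be \in Phi ->
  pos Phi a (u^T *m be) \/ pos Phi a (- (u^T *m be)).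
Proof. by move=> Wu be_in; apply: pos_or; apply: inW_root_tr. Qed.

Definition posroots : seq 'cV[R]_n := [seq be <- undup Phi | `[< pos Phi a be >]].

Lemma mem_posroots be : be \in posroots <-> pos Phi a be.
Proof.
rewrite mem_filter mem_undup; split=> [/andP[/asboolP]//|bp].
by rewrite (pos_root bp) andbT; apply/asboolP.
Qed.

(** Transposition is inversion on [W], so these are the labels of the edges of the full Bruhat graph
    that end at [w]. *)
Definition inversions w : seq 'cV[R]_n :=
  [seq be <- posroots | `[< pos Phi a (- (w^T *m be)) >]].

Lemma mem_inversions w be :
  be \in inversions w <-> pos Phi a be /\ pos Phi a (- (w^T *m be)).
Proof.
rewrite mem_filter; split=> [/andP[/asboolP + /mem_posroots]//|[/mem_posroots -> /asboolP ->]].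
by [].
Qed.

Lemma uniq_inversions w : uniq (inversions w).
Proof. by rewrite !filter_uniq ?undup_uniq. Qed.

Definition ell w := size (inversions w).

Lemma refl_mul_tr al w : (refl al *m w)^T = w^T *m refl al.
Proof. by rewrite trmx_mul refl_tr. Qed.

Lemma refl_mul_act al w : al \in Phi -> (refl al *m w)^T *m al = - (w^T *m al).
Proof.
by move=> al_in; rewrite refl_mul_tr -mulmxA refl_self ?root_neq0 // mulmxN.
Qed.

(** The reflection [s_ i] permutes the positive roots other than [a i], while [a i] itself becomes
    an inversion. *)
Lemma inversions_simple i w : W w -> pos Phi a (w^T *m a i) ->
  perm_eq (inversions (s_ i *m w)) (a i :: [seq s_ i *m be | be <- inversions w]).
Proof.
move=> Ww wi; have inj_s : injective (mulmx (s_ i) : 'cV[R]_n -> _).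
  by move=> x y xy; rewrite -(reflK x (simple_neq0 i)) xy reflK ?simple_neq0.
apply: uniq_perm; rewrite ?uniq_inversions //=.
  rewrite map_inj_uniq // uniq_inversions andbT; apply/negP => /mapP [be].
  move=> /mem_inversions [bp _] bE; apply: (posN (simple_pos i)).
  by rewrite -(refl_self (simple_neq0 i)) {2}bE reflK ?simple_neq0.
move=> be; rewrite inE; have siE : (s_ i *m w)^T = w^T *m s_ i by exact: refl_mul_tr.
apply/idP/idP.
  move=> /mem_inversions []; rewrite siE -mulmxA => bp bn.
  case: eqVneq => //= bi; apply/mapP; exists (s_ i *m be).
    by apply/mem_inversions; split => //; apply: simple_refl_pos => //; apply/eqP.
  by rewrite reflK ?simple_neq0.
case/orP => [/eqP ->|/mapP [al /mem_inversions [alp aln] ->]]; apply/mem_inversions.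
  split; first exact: simple_pos.
  by rewrite siE -mulmxA refl_self ?simple_neq0 // mulmxN opprK.
split; last by rewrite siE -mulmxA reflK ?simple_neq0.
by apply: simple_refl_pos => // ai; rewrite ai in aln; case: (posN wi).
Qed.

Lemma ell_up i w : W w -> pos Phi a (w^T *m a i) -> ell (s_ i *m w) = (ell w).+1.
Proof.
by move=> Ww wi; rewrite /ell (perm_size (inversions_simple Ww wi)) /= size_map.
Qed.

Lemma ell_down i w : W w -> pos Phi a (- (w^T *m a i)) -> ell w = (ell (s_ i *m w)).+1.
Proof.
move=> Ww wi; rewrite -(@ell_up i) ?reflKm ?simple_neq0 //; first exact: inW_simple.
by rewrite refl_mul_act ?simple_root.
Qed.

Lemma ell_ltP i w : W w -> (ell w < ell (s_ i *m w))%N <-> pos Phi a (w^T *m a i).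
Proof.
move=> Ww; split=> [lt|wi]; last by rewrite ell_up.
case: (pos_act Ww (simple_root i)) => // /(ell_down Ww) lE.
by rewrite lE ltnNge ltnW in lt.
Qed.

(* [be |-> s_al be] if that is positive, [be |-> be] otherwise, maps the
   inversions of [u] injectively into those of [s_al u], missing [al]. *)
Lemma ell_refl_lt u al : W u -> pos Phi a al -> pos Phi a (u^T *m al) ->
  (ell u < ell (refl al *m u))%N.
Proof.
move=> Wu alp ual; have al0 := root_neq0 (pos_root alp).
pose f be := if `[< pos Phi a (refl al *m be) >] then refl al *m be else be.
have f_inj : {in inversions u &, injective f}.
  move=> x y /mem_inversions [xp _] /mem_inversions [yp _]; rewrite /f.
  case: asboolP => sx; case: asboolP => sy // xy.
  - by rewrite -(reflK x al0) xy reflK.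
  - by case: sy; rewrite -xy reflK.
  - by case: sx; rewrite xy reflK.
have siE := refl_mul_tr al u.
rewrite -[ell u](size_map f) -[X in (X < _)%N]/(size (behead (al :: map f (inversions u)))).
apply: (@uniq_leq_size _ (al :: map f (inversions u))) => [|be] /=.
  rewrite map_inj_in_uniq // uniq_inversions andbT; apply/negP => /mapP [x].
  move=> /mem_inversions [xp xn]; rewrite /f; case: asboolP => sx alE.
    by case: (posN xp); rewrite -(reflK x al0) -alE refl_self // opprK.
  by rewrite -alE in xn; case: (posN ual).
rewrite inE => /orP [/eqP ->|/mapP [x /mem_inversions [xp xn] ->]]; apply/mem_inversions.
  by rewrite refl_mul_act ?pos_root // opprK.
rewrite /f; case: asboolP => sx.
  by split=> //; rewrite siE -mulmxA reflK.
split=> //; have sx_in := root_refl (pos_root alp) (pos_root xp).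
have {}sx : pos Phi a (- (refl al *m x)) by case: (pos_or sx_in).
apply: nonneg_pos.
  by apply: rootN; rewrite siE -mulmxA; apply: inW_root_tr.
pose c := 2 / dot al al * dot al x.
(* A negative [c] would make [refl al *m x], which is [x - c *: al], positive. *)
have c0 : 0 <= c.
  rewrite leNgt; apply/negP => c0; apply: (posN (be := refl al *m x)) sx.
  apply: nonneg_pos => //; rewrite refl_mul -/c -scaleNr.
  apply: nonnegD; first exact: pos_nonneg.
  by apply: nonnegZ; [rewrite oppr_ge0 ltW|exact: pos_nonneg].
(* The vector is the sum of [- (u^T *m x)] and [c *: (u^T *m al)], both in the cone. *)
rewrite siE -mulmxA refl_mul -/c mulmxBr opprB addrC -scalemxAr.
by apply: nonnegD; [exact: pos_nonneg|apply: nonnegZ => //; exact: pos_nonneg].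
Qed.

(** Reflexive Bruhat order with chains grown at the top: positivity of [v^T *m al] says that left
    multiplication by [refl al] raises the length. *)
Inductive ble u : 'M[R]_n -> Prop :=
| ble_refl : ble u u
| ble_step v al : ble u v -> pos Phi a al -> pos Phi a (v^T *m al) ->
    ble u (refl al *m v).

Lemma inW_refl_mul al w : al \in Phi -> W w -> W (refl al *m w).
Proof. by move=> al_in Ww; apply: inW_mul Ww; apply: inW_refl. Qed.

Lemma ble_W u v : W u -> ble u v -> W v.
Proof.
by move=> Wu; elim=> // w al _ Ww alp _; apply: inW_refl_mul (pos_root alp) Ww.
Qed.

Lemma ble_trans u v w : ble u v -> ble v w -> ble u w.
Proof. by move=> uv; elim=> // x al _ ux alp xal; apply: ble_step. Qed.

Lemma ble_leq u v : W u -> ble u v -> (ell u <= ell v)%N.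
Proof.
move=> Wu; elim=> // w al uw lw alp wal; apply: leq_trans lw (ltnW _).
by apply: ell_refl_lt => //; apply: ble_W uw.
Qed.

Lemma ble_eq u v : W u -> ble u v -> (ell v <= ell u)%N -> v = u.
Proof.
move=> Wu [] // w al uw alp wal; rewrite leqNgt => /negP [].
by apply: leq_ltn_trans (ble_leq Wu uw) _; apply: ell_refl_lt => //; apply: ble_W uw.
Qed.

(** The last step of a chain already uses up one unit of length, so the part below it is trivial. *)
Lemma ble_succ u v : W u -> ble u v -> u <> v -> (ell v <= (ell u).+1)%N ->
  exists al, [/\ pos Phi a al, pos Phi a (u^T *m al) & v = refl al *m u].
Proof.
move=> Wu [] // w al uw alp wal _ le; exists al; have Ww := ble_W Wu uw.
suff <- : w = u by [].
apply: ble_eq uw _ => //; rewrite -ltnS; apply: leq_trans le.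
exact: ell_refl_lt.
Qed.

(** Multiplying a chain by [s_ i] conjugates its labels, and those other than [a i] stay positive. A
    step labelled [a i] is undone, leaving its lower end, which lies above [s_ i *m w] through
    [w]. *)
Lemma ble_lift i w y : W w -> pos Phi a (- (w^T *m a i)) -> ble w y ->
  ble (s_ i *m w) (s_ i *m y).
Proof.
move=> Ww wi; elim=> [|v al wv IH alp val]; first exact: ble_refl.
have [->|/eqP ali] := eqVneq al (a i).
  rewrite reflKm ?simple_neq0 //; apply: ble_trans wv.
  rewrite -[X in ble _ X](@reflKm _ _ (a i)) ?simple_neq0 //.
  apply: ble_step (ble_refl _) (simple_pos i) _.
  by rewrite refl_mul_act ?simple_root.
have -> : s_ i *m (refl al *m v) = refl (s_ i *m al) *m (s_ i *m v).
  rewrite refl_conj ?refl_tr ?refl_sqr ?simple_neq0 // -!mulmxA.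
  by rewrite reflKm ?simple_neq0.
apply: ble_step => //; first exact: simple_refl_pos.
by rewrite refl_mul_tr -mulmxA reflK ?simple_neq0.
Qed.

Lemma ble_simple_down i w : W w -> pos Phi a (- (w^T *m a i)) -> ble (s_ i *m w) w.
Proof.
move=> Ww wi; rewrite -[X in ble _ X](@reflKm _ _ (a i)) ?simple_neq0 //.
apply: ble_step (ble_refl _) (simple_pos i) _.
by rewrite refl_mul_act ?simple_root.
Qed.

(** * Dominance of the highest root *)

Lemma gamma_root : gamma \in Phi.
Proof. by case: highP. Qed.

Lemma prec_nonneg al be : prec Phi a al be -> nonneg (be - al).
Proof.
move=> [s [sp ->]]; elim: s sp => [|x s IH] sp; first by rewrite big_nil; exact: nonneg0.
rewrite big_cons; apply: nonnegD; first by apply/pos_nonneg/sp; rewrite mem_head.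
by apply: IH => y ys; apply: sp; rewrite inE ys orbT.
Qed.

Lemma gamma_pos : pos Phi a gamma.
Proof.
apply: nonneg_pos gamma_root _.
(* Comparison with the root [- gamma] puts twice [gamma] in the cone. *)
have : nonneg (gamma - - gamma).
  by apply: prec_nonneg; case: highP => _; apply; apply: rootN gamma_root.
rewrite opprK -mulr2n -scaler_nat => /(@nonnegZ 2^-1).
by rewrite scalerA mulVf ?pnatr_eq0 // scale1r invr_ge0 ler0n; apply.
Qed.

(** The difference [gamma - refl be *m gamma] lies in the cone and is a multiple of [be] with the
    sign of [dot be gamma]. *)
Lemma gamma_dominant be : pos Phi a be -> 0 <= dot be gamma.
Proof.
move=> bp; have b0 := root_neq0 (pos_root bp).
have : nonneg (gamma - refl be *m gamma).
  apply: prec_nonneg; case: highP => _; apply.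
  by apply: root_refl gamma_root; exact: pos_root.
rewrite refl_mul opprB addrC subrK => nn; rewrite leNgt; apply/negP => bg.
have : nonneg (- be).
  have := @nonnegZ (- (2 / dot be be * dot be gamma))^-1 _ _ nn.
  rewrite scalerA invrN mulNr mulVf ?scaleN1r; first apply.
    rewrite oppr_ge0 invr_le0 mulr_ge0_le0 //; last exact: ltW.
    by rewrite divr_ge0 // ltW // dot_gt0.
  by rewrite !mulf_neq0 ?invr_neq0 ?pnatr_eq0 ?(gt_eqF (dot_gt0 b0)) ?(lt_eqF bg).
move=> bn; have := b0; by rewrite (nonneg_anti (pos_nonneg bp) bn) eqxx.
Qed.

(** The step subtracts from [v *m gamma] a multiple of [al] with the sign of
    [dot (v^T *m al) gamma], nonnegative by dominance. *)
Lemma neg_step v al : W v -> pos Phi a al -> pos Phi a (v^T *m al) ->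
  pos Phi a (- (v *m gamma)) -> pos Phi a (- (refl al *m v *m gamma)).
Proof.
move=> Wv alp val vg; apply: nonneg_pos.
  apply: rootN; apply: inW_root gamma_root.
  exact: inW_refl_mul (pos_root alp) Wv.
rewrite -mulmxA refl_mul opprB addrC; apply: nonnegD; first exact: pos_nonneg.
apply: nonnegZ; last exact: pos_nonneg.
rewrite mulr_ge0 //; last by rewrite dot_mul; exact: gamma_dominant.
by rewrite divr_ge0 // ltW // dot_gt0 // root_neq0 // pos_root.
Qed.

Lemma ble_neg w y : W w -> ble w y ->
  pos Phi a (- (w *m gamma)) -> pos Phi a (- (y *m gamma)).
Proof.
move=> Ww wy wn; elim: wy => // v al wv IH alp val.
by apply: neg_step => //; exact: ble_W wv.
Qed.

(** * Schubert classes *)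

Definition full_gkm F := forall u al, W u -> pos Phi a al ->
  ldvd al (F u - F (refl al *m u)).

Lemma pos_not_prop al be c : pos Phi a al -> pos Phi a be -> al <> be -> al <> c *: be.
Proof.
move=> alp bp ab abE; case: (root_prop (pos_root alp) (pos_root bp) abE) => // alE.
by rewrite alE in alp; case: (posN bp).
Qed.

Lemma ldvd_cancel al be p : pos Phi a al -> be \in Phi -> be <> al -> be <> - al ->
  ldvd al (linpoly be * p) -> ldvd al p.
Proof.
move=> alp be_in ba bna /(ldvd_prime (root_neq0 (pos_root alp))) [] //.
move=> /(ldvd_linpoly (root_neq0 (pos_root alp))) [c bE].
by case: (root_prop be_in (pos_root alp) bE).
Qed.

Lemma homog_quotient al p d : al != 0 ->
  linpoly al * p \is d.+1.-homog -> p \is d.-homog.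
Proof.
move=> al0 ph; have [->|p0] := eqVneq p 0; first exact: dhomog0.
have [|_] := dhomog_div (linpoly_homog al) ph; first by rewrite mulf_neq0 ?linpoly_neq0.
by rewrite subn1.
Qed.

Lemma act_prod (M : 'M[R]_n) (s : seq 'cV[R]_n) :
  act M (\prod_(v <- s) linpoly v) = \prod_(v <- [seq M *m v | v : 'cV[R]_n <- s]) linpoly v.
Proof.
rewrite big_map rmorph_prod; apply: eq_bigr => v _; exact: act_linpoly.
Qed.

(* Left divided difference by the simple reflection [s_i]. *)
Lemma schubert_descent i w F : W w -> pos Phi a (w^T *m a i) -> full_gkm F ->
  homdeg a (ell (s_ i *m w)) F ->
  F (s_ i *m w) = \prod_(al <- inversions (s_ i *m w)) linpoly al ->
  (forall y, W y -> F y <> 0 -> ble (s_ i *m w) y) ->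
  exists G : cls R n, [/\ full_gkm G, homdeg a (ell w) G,
    G w = \prod_(al <- inversions w) linpoly al &
    forall y, W y -> G y <> 0 -> ble w y].
Proof.
move=> Ww wi Fg Fh Fw Fs; have ai0 := simple_neq0 i.
have Wsw : W (s_ i *m w) by exact: inW_simple.
have swi : pos Phi a (- ((s_ i *m w)^T *m a i)).
  by rewrite refl_mul_act ?simple_root // opprK.
(* The twisted difference splits into a GKM difference and a term [p - act (s_ i) p], both divisible
   by [a i]; [G] is the quotient. *)
have /choice [G GE] : forall y, exists q, W y ->
    F y - act (s_ i) (F (s_ i *m y)) = linpoly (a i) * q.
  move=> y; have [Wy|nWy] := pselect (W y); last by exists 0.
  have : ldvd (a i) (F y - act (s_ i) (F (s_ i *m y))).
    rewrite -(subrK (F (s_ i *m y)) (F y)) -addrA; apply: ldvdD.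
      exact: Fg (simple_pos i).
    exact: act_refl_sub.
  by move=> [q qE]; exists q.
have linI : injective ( *%R (linpoly (a i))).
  by apply: mulfI; exact: linpoly_neq0.
exists G; split.
- move=> u al Wu alp; have Wsu := inW_simple i Wu.
  have [->|/eqP ali] := eqVneq al (a i).
    (* Applying [s_ i] to the equation defining [G u] gives this equivariance. *)
    suff -> : G (s_ i *m u) = act (s_ i) (G u) by exact: act_refl_sub.
    apply: linI; rewrite /= -GE // reflKm //.
    have := congr1 (comp_mpoly (linpoly_cols (s_ i))) (GE u Wu).
    rewrite rmorphB rmorphM /= act_reflK // act_linpoly refl_self // linpolyN mulNr.
    by move=> /eqP; rewrite -eqr_oppLR opprB => /eqP.
  have nai : a i <> - al.
    by move=> aiE; apply: (posN alp); rewrite -aiE; exact: simple_pos.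
  apply: (ldvd_cancel alp (simple_root i) (nesym ali) nai).
  have Wau := inW_refl_mul (pos_root alp) Wu.
  have siE : s_ i *m (refl al *m u) = refl (s_ i *m al) *m (s_ i *m u).
    by rewrite refl_conj ?refl_tr ?refl_sqr // -!mulmxA reflKm.
  have -> : linpoly (a i) * (G u - G (refl al *m u)) = (F u - F (refl al *m u))
      - act (s_ i) (F (s_ i *m u) - F (refl (s_ i *m al) *m (s_ i *m u))).
    rewrite mulrBr -!GE // siE rmorphB !opprB addrACA [RHS]addrACA.
    by congr (_ + _); rewrite addrC.
  apply: ldvdB; first exact: Fg.
  rewrite -[X in ldvd X _](reflK al ai0); apply: ldvd_act.
  by apply: Fg => //; exact: simple_refl_pos.
- move=> y Wy; apply: (@homog_quotient (a i)) => //; rewrite -GE // -(ell_up Ww wi).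
  by rewrite rpredB ?act_homog ?Fh //; exact: inW_simple.
- apply: linI; rewrite /= -GE // Fw act_prod.
  (* The support of [F] lies above [s_ i *m w], which is longer than [w]. *)
  have -> : F w = 0.
    apply: contrapT => /(Fs _ Ww)/(ble_leq Wsw).
    by rewrite ell_up // ltnn.
  rewrite (perm_big _ (perm_map _ (inversions_simple Ww wi))) /= big_cons -map_comp.
  rewrite refl_self // linpolyN mulNr sub0r opprK big_map; congr (_ * _).
  by apply: eq_bigr => be _; rewrite /= reflK.
move=> y Wy Gy.
have [Fy|Fy] : F y <> 0 \/ F (s_ i *m y) <> 0.
  apply: contrapT => H; apply: Gy; apply: linI; rewrite /= mulr0 -GE //.
  have [-> ->] : F y = 0 /\ F (s_ i *m y) = 0.
    by split; apply: contrapT => Fy; apply: H; [left|right].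
  by rewrite rmorph0 subr0.
- apply: ble_trans (Fs _ Wy Fy).
  rewrite -{1}[w](@reflKm _ _ (a i)) //; exact: ble_simple_down.
have := ble_lift Wsw swi (Fs _ (inW_simple i Wy) Fy).
by rewrite !reflKm.
Qed.

(** Downward induction on length: an ascent of [w] gives a longer element to descend from. Without
    ascents every positive root is an inversion, so the class supported at [w] alone satisfies all
    divisibility conditions. *)
Lemma schubert_class w : W w -> exists F : cls R n, [/\ full_gkm F, homdeg a (ell w) F,
    F w = \prod_(al <- inversions w) linpoly al &
    forall y, W y -> F y <> 0 -> ble w y].
Proof.
have [N] := ubnP (size posroots - ell w)%N; elim: N w => // N IH w wN Ww.
have [[i wi]|wmax] := pselect (exists i, pos Phi a (w^T *m a i)).
  have [||F [Fg Fh Fw Fs]] := IH (s_ i *m w); last exact: (schubert_descent Ww wi Fg).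
    rewrite ell_up // subnS; have : (ell (s_ i *m w) <= size posroots)%N.
      by rewrite /ell size_filter count_size.
    by rewrite ell_up //; move: wN; lia.
  exact: inW_simple.
have inv_w be : pos Phi a be -> be \in inversions w.
  move=> bp; apply/mem_inversions; split=> //; apply: nonneg_pos.
    by apply: rootN; apply: inW_root_tr (pos_root bp).
  have [c c0 ->] := pos_nonneg bp; rewrite mulmx_sumr -sumrN.
  elim/big_ind: _ => [||i _]; [exact: nonneg0|exact: nonnegD|].
  rewrite -scalemxAr -scalerN; apply: nonnegZ => //; apply: pos_nonneg.
  case: (pos_act Ww (simple_root i)) => // wi; case: wmax; by exists i.
have prodE be : pos Phi a be -> ldvd be (\prod_(al <- inversions w) linpoly al).
  move=> /inv_w bw; rewrite (big_rem _ bw) /=; by exists (\prod_(al <- rem be (inversions w)) linpoly al).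
exists (fun y => if y == w then \prod_(al <- inversions w) linpoly al else 0); split.
- move=> u al Wu alp; apply: ldvdB; case: ifP => _; by [exact: ldvd0|exact: prodE].
- by move=> y Wy; case: ifP => _; [exact: prod_linpoly_homog|exact: dhomog0].
- by rewrite eqxx.
by move=> y Wy; case: eqVneq => // -> _; exact: ble_refl.
Qed.

(** * Flow-up classes for the complement of the highest root *)

Local Notation h := (h_gamma Phi a gamma).

Definition hinversions w : seq 'cV[R]_n :=
  [seq al <- inversions w | - (w^T *m al) != gamma].

Lemma mem_hinversions w al : al \in hinversions w <->
  [/\ pos Phi a al, pos Phi a (- (w^T *m al)) & - (w^T *m al) <> gamma].
Proof.
rewrite mem_filter; split=> [/andP[/eqP ng /mem_inversions[alp aln]]//|[alp aln /eqP ->]].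
exact/mem_inversions.
Qed.

Lemma uniq_hinversions w : uniq (hinversions w).
Proof. by rewrite filter_uniq ?uniq_inversions. Qed.

Lemma hess_edgeP al u x : W x ->
  hess_edge Phi a h al u x <-> al \in hinversions x /\ u = refl al *m x.
Proof.
move=> Wx; split=> [[Wu alp xE [hp ng]]|[/mem_hinversions [alp xal ng] ->]].
  have al0 := root_neq0 (pos_root alp).
  split; last by rewrite xE reflKm.
  by rewrite (inW_inv Wx) in hp ng; apply/mem_hinversions.
have al0 := root_neq0 (pos_root alp).
split=> //; [exact: inW_refl_mul (pos_root alp) Wx|by rewrite reflKm|].
by rewrite (inW_inv Wx).
Qed.

Lemma hess_edge_up al v : W v -> pos Phi a al -> pos Phi a (v^T *m al) ->
  v^T *m al <> gamma -> hess_edge Phi a h al v (refl al *m v).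
Proof.
move=> Wv alp val ng; have al_in := pos_root alp.
apply/hess_edgeP; first exact: inW_refl_mul.
rewrite reflKm ?root_neq0 //; split=> //; apply/mem_hinversions.
by rewrite refl_mul_act // opprK.
Qed.

Lemma hess_edge_W al u x : hess_edge Phi a h al u x -> W x.
Proof. by move=> [Wu alp -> _]; exact: inW_refl_mul (pos_root alp) Wu. Qed.

Lemma hess_edge_ble al u x : hess_edge Phi a h al u x -> ble u x.
Proof.
move=> e; have Wx := hess_edge_W e.
have [/mem_hinversions [alp aln _] uE] := (hess_edgeP al u Wx).1 e.
have al_in := pos_root alp; have al0 := root_neq0 al_in.
rewrite -[x](reflKm _ al0) -uE; apply: ble_step (ble_refl _) alp _.
by rewrite uE refl_mul_act.
Qed.

Lemma hess_lt_ble u x : hess_lt Phi a h u x -> ble u x.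
Proof.
by elim=> [al v y /hess_edge_ble|v y z _ vy _ yz] //; exact: ble_trans vy yz.
Qed.

Lemma hess_lt_ell u x : hess_lt Phi a h u x -> (ell u < ell x)%N.
Proof.
elim=> [al v y e|v y z _ vy _ yz]; last exact: ltn_trans vy yz.
have Wy := hess_edge_W e; have [Wv _ _ _] := e.
have [/mem_hinversions [alp aln _] uE] := (hess_edgeP al v Wy).1 e.
have al0 := root_neq0 (pos_root alp).
rewrite -[y](reflKm _ al0) -uE; apply: ell_refl_lt => //.
by rewrite uE refl_mul_act ?pos_root.
Qed.

(* The edges missing from the Hessenberg graph change the sign of the image
   of [gamma], so a Bruhat chain along which that sign is constant survives. *)
Lemma ble_hess_lt w y : W w -> ble w y ->
  pos Phi a (- (w *m gamma)) \/ pos Phi a (y *m gamma) ->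
  y = w \/ hess_lt Phi a h w y.
Proof.
move=> Ww; elim=> [|v al wv IH alp val] sgn; first by left.
have Wv := ble_W Ww wv.
have sgn_v : pos Phi a (- (w *m gamma)) \/ pos Phi a (v *m gamma).
  case: sgn => [|yg]; [by left|right].
  case: (pos_or (inW_root Wv gamma_root)) => // vn.
  by case: (posN yg); exact: neg_step.
have e : hess_edge Phi a h al v (refl al *m v).
  apply: hess_edge_up => // vg.
  have alE : v *m gamma = al by rewrite -vg inW_Ktr.
  case: sgn => [/(ble_neg Ww wv)|]; first by rewrite alE; exact: posN.
  rewrite -mulmxA alE refl_self ?root_neq0 ?pos_root //; exact: posN.
right; case: (IH sgn_v) => [vw|wv']; first by rewrite -vw; apply: hess_lt1 e.
by apply: hess_lt_trans wv' (hess_lt1 e).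
Qed.

(** Divisibility ignores the sign of the difference, so edges lose their orientation at the price of
    excluding both signs of [gamma]. *)
Lemma gkmP P : gkm Phi a h P <-> forall u al, W u -> pos Phi a al ->
  u^T *m al <> gamma -> - (u^T *m al) <> gamma -> ldvd al (P u - P (refl al *m u)).
Proof.
split=> [Pg u al Wu alp ng ngN|Pg al u x e].
  case: (pos_act Wu (pos_root alp)) => ual.
    exact: (Pg al u _ (hess_edge_up Wu alp ual ng)).
  have e : hess_edge Phi a h al (refl al *m u) u.
    by apply/hess_edgeP => //; split=> //; apply/mem_hinversions.
  by have := ldvdN (Pg _ _ _ e); rewrite opprB.
have Wx := hess_edge_W e; have [Wu alp xE _] := e.
have [/mem_hinversions [_ aln ng] uE] := (hess_edgeP al u Wx).1 e.
have al_in := pos_root alp.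
rewrite xE; apply: Pg => //; rewrite uE refl_mul_act //.
rewrite opprK => xg; case: (posN gamma_pos); rewrite -xg; exact: aln.
Qed.

(** Each edge into [y] makes its label divide [P y], and distinct positive roots are not
    proportional. *)
Lemma gkm_dvd_prod P y : gkm Phi a h P -> W y ->
  (forall al, al \in hinversions y -> P (refl al *m y) = 0) ->
  exists q, P y = (\prod_(al <- hinversions y) linpoly al) * q.
Proof.
move=> Pg Wy P0; apply: prod_linpoly_dvd; first exact: uniq_hinversions.
- by apply/negP => /mem_hinversions [/pos_root/root_neq0/eqP].
- move=> al be /mem_hinversions [alp _ _] /mem_hinversions [bp _ _] ab c.
  exact: pos_not_prop.
move=> al al_in; have e : hess_edge Phi a h al (refl al *m y) y by apply/hess_edgeP.
by have := ldvdN (Pg _ _ _ e); rewrite P0 // sub0r opprK.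
Qed.

Lemma prod_hinversions_neq0 w : \prod_(al <- hinversions w) linpoly al != 0.
Proof.
apply: prod_linpoly_neq0.
by apply/negP => /mem_hinversions [/pos_root/root_neq0/eqP].
Qed.

Lemma hinversions_pos w : W w -> pos Phi a (w *m gamma) ->
  hinversions w = inversions w.
Proof.
move=> Ww wp; apply/all_filterP/allP => al /mem_inversions [alp _].
apply/eqP => alE; apply: (posN alp).
by rewrite -(inW_Ktr al Ww) -mulmxN alE.
Qed.

Lemma inversions_neg w : W w -> pos Phi a (- (w *m gamma)) ->
  perm_eq (inversions w) (- (w *m gamma) :: hinversions w).
Proof.
move=> Ww wn; have wgK : w^T *m (- (w *m gamma)) = - gamma.
  by rewrite mulmxN inW_trK.
apply: uniq_perm; rewrite ?uniq_inversions //= ?uniq_hinversions ?andbT.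
  by apply/negP => /mem_hinversions [_ _]; rewrite wgK opprK.
move=> al; rewrite inE; apply/idP/idP.
  move=> al_in; rewrite mem_filter al_in andbT.
  case: eqVneq => //= /eqP alE; apply/eqP => wal; apply: alE.
  by rewrite -wal mulmxN opprK inW_Ktr.
case/orP => [/eqP ->|]; last by rewrite mem_filter => /andP[].
by apply/mem_inversions; rewrite wgK opprK; split=> //; exact: gamma_pos.
Qed.

Lemma ell_neg w : W w -> pos Phi a (- (w *m gamma)) -> ell w = (size (hinversions w)).+1.
Proof. by move=> Ww wn; rewrite /ell (perm_size (inversions_neg Ww wn)). Qed.

Definition is_flowup w P := [/\ gkm Phi a h P, homdeg a (size (hinversions w)) P,
  P w = \prod_(al <- hinversions w) linpoly al &
  forall y, W y -> P y <> 0 -> y = w \/ hess_lt Phi a h w y].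

Lemma is_flowupP w P : W w -> is_flowup w P -> flowup Phi a h w P.
Proof.
move=> Ww [Pg Ph Pw Ps]; split=> //; exists (hinversions w); split=> //.
  exact: uniq_hinversions.
move=> al; split=> [al_in|[u /(hess_edgeP _ _ Ww) []//]].
by exists (refl al *m w); apply/hess_edgeP.
Qed.

Lemma full_gkmW F : full_gkm F -> gkm Phi a h F.
Proof. by move=> Fg; apply/gkmP => u al Wu alp _ _; apply: Fg. Qed.

Lemma gkm_combine (f g : {mpoly R[n]}) P F : gkm Phi a h P -> gkm Phi a h F ->
  gkm Phi a h (fun w => f * P w + g * F w).
Proof.
move=> Pg Fg al u w e.
have -> : f * P u + g * F u - (f * P w + g * F w)
  = f * (P u - P w) + g * (F u - F w) by rewrite opprD addrACA !mulrBr.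
by apply: (ldvdD (ldvdMl _ (Pg _ _ _ e)) (ldvdMl _ (Fg _ _ _ e))).
Qed.

(* If [w gamma < 0], the Schubert class of [w] vanishes wherever
   [y gamma > 0], hence is divisible by [y gamma] everywhere. *)
Lemma flowup_neg w : W w -> pos Phi a (- (w *m gamma)) -> exists P, is_flowup w P.
Proof.
move=> Ww wn; have [F [Fg Fh Fw Fs]] := schubert_class Ww.
have yg_in y : W y -> y *m gamma \in Phi by move=> Wy; exact: inW_root gamma_root.
have F0 y : W y -> pos Phi a (y *m gamma) -> F y = 0.
  move=> Wy yp; apply: contrapT => /(Fs _ Wy) wy.
  exact: (posN yp (ble_neg Ww wy wn)).
(* Where [y *m gamma] is positive, [F] vanishes and the quotient is taken to be 0. Elsewhere the
   edge labelled [- (y *m gamma)] leads to a point where [F] vanishes, and the GKM condition gives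
   divisibility. *)
have /choice [P PE] : forall y, exists q, W y -> F y = linpoly (- (y *m gamma)) * q.
  move=> y; have [Wy|nWy] := pselect (W y); last by exists 0.
  case: (pos_or (yg_in y Wy)) => yg; first by exists 0; rewrite F0 // mulr0.
  have [q] := Fg y _ Wy yg; rewrite (F0 (refl _ *m y)) ?subr0; first by exists q.
    exact: inW_refl_mul (pos_root yg) Wy.
  by rewrite -mulmxA -[y *m gamma]opprK mulmxN opprK refl_self ?opprK // root_neq0 ?pos_root.
have yg0 y : W y -> - (y *m gamma) != 0.
  by move=> Wy; rewrite oppr_eq0 root_neq0 ?yg_in.
exists P; split.
- apply/gkmP => u al Wu alp ng ngN; have al_in := pos_root alp.
  have Wv := inW_refl_mul al_in Wu; set v := refl al *m u in Wv *.
  (* On a Hessenberg edge [al] is not proportional to [y *m gamma], so that factor can be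
     cancelled. *)
  have cancel_g y p : W y -> y^T *m al <> gamma -> - (y^T *m al) <> gamma ->
      ldvd al (linpoly (- (y *m gamma)) * p) -> ldvd al p.
    move=> Wy yng yngN; apply: ldvd_cancel => //; first exact/rootN/yg_in.
      by move=> alE; apply: yngN; rewrite -alE mulmxN opprK inW_trK.
    by move/oppr_inj => alE; apply: yng; rewrite -alE inW_trK.
  apply: (cancel_g u) => //; apply: (cancel_g v) => //.
  + by rewrite refl_mul_act.
  + by rewrite refl_mul_act // opprK.
  (* With denominators cleared, one term contains [F u - F v] and the other the difference of
     [u *m gamma] and [v *m gamma], a multiple of [al]. *)
  have -> : linpoly (- (v *m gamma)) * (linpoly (- (u *m gamma)) * (P u - P v))
      = linpoly (- (v *m gamma)) * (F u - F v)
        - (linpoly (- (u *m gamma)) - linpoly (- (v *m gamma))) * F v.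
    rewrite (PE u Wu) (PE v Wv); move: (linpoly (- (v *m gamma))) => x.
    move: (linpoly (- (u *m gamma))) => z.
    rewrite !mulrBr mulrBl opprB addrA subrK; congr (_ - _); exact: mulrCA.
  apply: ldvdB; first by apply: ldvdMl; apply: Fg.
  apply: ldvdMr; rewrite -linpolyB opprK addrC /v -mulmxA refl_mul addrAC subrr sub0r.
  by rewrite -scaleNr linpolyZ; exists (- (2 / dot al al * dot al (u *m gamma)))%:MP;
    rewrite -mul_mpolyC mulrC.
- move=> y Wy; apply: (homog_quotient (yg0 y Wy)).
  by rewrite -PE // -ell_neg //; apply: Fh.
- have linI : injective ( *%R (linpoly (- (w *m gamma)))).
    by apply: mulfI; apply: linpoly_neq0; exact: yg0.
  apply: linI; rewrite /= -PE // Fw (perm_big _ (inversions_neg Ww wn)) /=.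
  by rewrite big_cons.
move=> y Wy Py; apply: ble_hess_lt; [by []| |by left].
apply: Fs => // Fy; apply: Py.
apply/eqP; have /eqP := PE y Wy; rewrite Fy eq_sym mulf_eq0.
by rewrite (negbTE (linpoly_neq0 (yg0 y Wy))).
Qed.

(* A class supported above [w] in the Bruhat order, of degree [ell w], is
   already supported above [w] in the Hessenberg order unless it is nonzero at
   the neighbour [w s_gamma]: at a minimal bad point [y] its value would be
   divisible by a product of [ell y - 1] roots, so [ell y <= ell w + 1]. *)
Lemma flowup_support w P : W w -> gkm Phi a h P -> homdeg a (ell w) P ->
  (forall y, W y -> P y <> 0 -> ble w y) ->
  (ell (w *m refl gamma) = (ell w).+1 -> P (w *m refl gamma) = 0) ->
  forall y, W y -> P y <> 0 -> y = w \/ hess_lt Phi a h w y.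
Proof.
move=> Ww Pg Ph Ps Pwg y.
have [N] := ubnP (ell y); elim: N y => // N IH y yN Wy Py.
apply: contrapT => H; have wy := Ps y Wy Py.
have yw : w <> y by move=> yE; apply: H; left.
(* If [y *m gamma] were positive, the Bruhat chain from [w] to [y] would consist of Hessenberg
   edges. *)
have yn : pos Phi a (- (y *m gamma)).
  case: (pos_or (inW_root Wy gamma_root)) => // yp.
  by case: H; apply: ble_hess_lt => //; right.
have P0 al : al \in hinversions y -> P (refl al *m y) = 0.
  move=> al_in; apply: contrapT => Pal.
  have e : hess_edge Phi a h al (refl al *m y) y by apply/hess_edgeP.
  have [Wal _ _ _] := e.
  case: (IH (refl al *m y)) => //.
  - by rewrite -ltnS; apply: leq_trans yN; rewrite ltnS; exact: hess_lt_ell (hess_lt1 e).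
  - by move=> alE; apply: H; right; rewrite alE in e; exact: hess_lt1 e.
  - by move=> wal; apply: H; right; exact: hess_lt_trans wal (hess_lt1 e).
have [q qE] := gkm_dvd_prod Pg Wy P0.
have [] := dhomog_div (d := ell w) (q := q) (prod_linpoly_homog (hinversions y)).
- by rewrite -qE; exact: Ph.
- by rewrite -qE; apply/eqP.
rewrite -ltnS -ell_neg // => yl _.
(* Now [y] is one reflection above [w]: either this is a Hessenberg edge, or [y] is
   [w *m refl gamma], where [P] vanishes by hypothesis. *)
have [al [alp wal yE]] := ble_succ Ww wy yw yl.
have [wg|ng] := pselect (w^T *m al = gamma); last first.
  by apply: H; right; rewrite yE; apply: hess_lt1 (hess_edge_up Ww alp wal ng).
have wgE : w *m refl gamma = y.
  rewrite yE -[al](inW_Ktr _ Ww) wg refl_conj ?inW_multr //.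
  by rewrite -mulmxA inW_trmul // mulmx1.
apply: Py; rewrite -wgE; apply: Pwg; rewrite wgE.
apply/eqP; rewrite eqn_leq yl yE; exact: ell_refl_lt.
Qed.

Lemma flowup_exists w : W w -> exists P, is_flowup w P.
Proof.
move=> Ww; case: (pos_or (inW_root Ww gamma_root)) => wp; last exact: flowup_neg.
have [F [Fg Fh Fw Fs]] := schubert_class Ww.
set v := w *m refl gamma.
have wg_in : w *m gamma \in Phi := inW_root Ww gamma_root.
have wg0 := root_neq0 wg_in.
have vE : v = refl (w *m gamma) *m w.
  by rewrite refl_conj ?inW_multr // -mulmxA inW_trmul // mulmx1.
have Wv : W v by rewrite vE; exact: inW_refl_mul.
have vg : v *m gamma = - (w *m gamma) by rewrite vE -mulmxA refl_self.
have vn : pos Phi a (- (v *m gamma)) by rewrite vg opprK.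
have wv : ble w v.
  rewrite vE; apply: ble_step (ble_refl _) wp _.
  by rewrite inW_trK //; exact: gamma_pos.
have flowupF P : gkm Phi a h P -> homdeg a (ell w) P -> P w = F w ->
    (forall y, W y -> P y <> 0 -> ble w y) -> (ell v = (ell w).+1 -> P v = 0) ->
    is_flowup w P.
  move=> Pg Ph Pw Ps Pv; split=> //.
  - by rewrite hinversions_pos.
  - by rewrite hinversions_pos // Pw.
  - exact: flowup_support.
have [lv|lv] := eqVneq (ell v) (ell w).+1; last first.
  by exists F; apply: flowupF => //; [exact: full_gkmW|move=> /eqP; rewrite (negbTE lv)].
have [P [Pg Ph Pv Ps]] := flowup_neg Wv vn.
have hv : size (hinversions v) = ell w by apply: succn_inj; rewrite -ell_neg.
(* A lower neighbour of [v] in the support of [F] must be [w] by length; the label would then be the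
   positive root [w *m gamma], which is not the label of a Hessenberg edge into [v]. *)
have F0 al : al \in hinversions v -> F (refl al *m v) = 0.
  move=> al_in; apply: contrapT => Fal.
  have e : hess_edge Phi a h al (refl al *m v) v by apply/hess_edgeP.
  have [Wal alp _ _] := e.
  have lal : (ell (refl al *m v) <= ell w)%N.
    by rewrite -ltnS -lv; exact: hess_lt_ell (hess_lt1 e).
  have walE := ble_eq Ww (Fs _ Wal Fal) lal.
  have al0 := root_neq0 (pos_root alp).
  have alg : refl al *m (w *m gamma) = - (w *m gamma).
    by rewrite mulmxA -[in LHS]walE reflKm // vg.
  have /(root_prop wg_in (pos_root alp)) [] : w *m gamma
      = (2 / dot al al * dot al (w *m gamma) / 2) *: al.
    rewrite [X in X *: _]mulrC -scalerA; move: alg; rewrite refl_mul.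
    move=> /eqP; rewrite subr_eq addrC -subr_eq opprK => /eqP <-.
    by rewrite -mulr2n -scaler_nat scalerA mulVf ?scale1r ?pnatr_eq0.
  - move=> wal; have /mem_hinversions [_ _] := al_in; apply.
    by rewrite -wal vE refl_mul_tr -mulmxA refl_self // mulmxN opprK inW_trK.
  - by move=> wal; rewrite wal in wp; exact: posN wp.
have [c cE] := gkm_dvd_prod (full_gkmW Fg) Wv F0.
(* Both [F v] and the product of labels have degree [ell w], so the cofactor is a constant. *)
have ch : c \is 0.-homog.
  have [->|c0] := eqVneq c 0; first exact: dhomog0.
  have [||_] := dhomog_div (d := ell w) (q := c) (prod_linpoly_homog (hinversions v)).
  - by rewrite -cE; exact: Fh.
  - by rewrite mulf_neq0 ?prod_hinversions_neq0.
  by rewrite hv subnn.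
(* The constant [c] is chosen to cancel the value at [v]; the value at [w] is unchanged, since [P]
   vanishes at the shorter element [w]. *)
exists (fun y => 1 * F y + (- c) * P y); apply: flowupF.
- by apply: gkm_combine => //; exact: full_gkmW.
- move=> y Wy; rewrite mul1r mulNr; apply: rpredB; first exact: Fh.
  by rewrite -[ell w]add0n; apply: dhomogM => //; rewrite -hv; exact: Ph.
- have -> : P w = 0.
    apply: contrapT => /(Ps _ Ww) [wE|/hess_lt_ell].
      by have := lv; rewrite -wE => /eqP; rewrite ltn_eqF.
    by rewrite lv ltnNge leqnSn.
  by rewrite mul1r mulr0 addr0.
- move=> y Wy Qy; have [Fy|Fy] := eqVneq (F y) 0; last by apply: Fs => //; apply/eqP.
  apply: (ble_trans wv); case: (Ps y Wy) => [Py|->|/hess_lt_ble //]; last exact: ble_refl.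
  by apply: Qy; rewrite Fy Py !mulr0 addr0.
- by move=> _; rewrite mul1r cE Pv mulrC mulNr subrr.
Qed.

(** * Divided difference operators on the basis of flow-up classes *)

(** An element of [W] is determined by how it permutes [Phi], because [Phi] spans the space. *)
Lemma inW_finite : exists L : seq 'M[R]_n, uniq L /\ forall w, w \in L <-> W w.
Proof.
(* Since [index] may reach [size Phi], the codomain has one extra value and [inord] loses
   nothing. *)
pose code w := [ffun j : 'I_(size Phi) => inord (index (w *m Phi`_j) Phi) : 'I_(size Phi).+1].
have code_inj u w : W u -> W w -> code u = code w -> u = w.
  move=> Wu Ww uw; apply: mulmx_ext => v; case: rootsP => _ /(_ v) [c ->] _ _ _.
  rewrite !mulmx_sumr; apply: eq_bigr => j _; rewrite -!scalemxAr; congr (_ *: _).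
  have j_in : Phi`_j \in Phi by exact: mem_nth.
  have /(congr1 val) /= := (ffunP _ _).2 uw j.
  rewrite !ffunE !inordK ?ltnS ?index_size // => /(congr1 (nth 0 Phi)).
  by rewrite !nth_index ?inW_root.
have /choice [f fP] : forall g, exists w, (exists2 w', W w' & code w' = g) ->
    W w /\ code w = g.
  move=> g; have [[w' Ww' wg]|H] := pselect (exists2 w', W w' & code w' = g).
    by exists w'.
  by exists 1%:M => /H.
exists (undup [seq f g | g <- enum {: {ffun 'I_(size Phi) -> 'I_(size Phi).+1}}
  & `[< W (f g) >]]).
split=> [|w]; first exact: undup_uniq.
rewrite mem_undup; split=> [/mapP [g]|Ww].
  by rewrite mem_filter => /andP [/asboolP Wf _] ->.
have [Wf cf] : W (f (code w)) /\ code (f (code w)) = code w by apply: fP; exists w.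
apply/mapP; exists (code w); last exact: code_inj.
by rewrite mem_filter mem_enum andbT; apply/asboolP.
Qed.

Lemma ell_le_posroots w : (ell w <= size posroots)%N.
Proof. by rewrite /ell size_filter count_size. Qed.

Lemma bruhat_lt_ell u w : bruhat_lt Phi a u w -> (ell u < ell w)%N.
Proof.
elim=> [x v [Wx [al [alp [vE vn]]]]|x v y _ xv _ vy]; last exact: ltn_trans vy.
have al_in := pos_root alp.
rewrite vE inW_inv in vn; last exact: inW_refl_mul.
by rewrite vE; apply: ell_refl_lt => //; move: vn; rewrite refl_mul_act // opprK.
Qed.

Lemma ell_simple_le i w : W w -> (ell (s_ i *m w) <= (ell w).+1)%N.
Proof.
move=> Ww; case: (pos_act Ww (simple_root i)) => [/(ell_up Ww) ->//|].
by move=> /(ell_down Ww) ->; rewrite ltnW.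
Qed.

Lemma ell_word_le s w : W w -> (ell ((word_mx a s)^T *m w) <= ell w + size s)%N.
Proof.
elim: s w => [|i s IH] w Ww /=; first by rewrite trmx1 mul1mx addn0.
rewrite trmx_mul refl_tr -mulmxA; apply: leq_trans (IH _ (inW_simple i Ww)) _.
by rewrite addnS -addSn leq_add2r; exact: ell_simple_le.
Qed.

Lemma ell_simple_neq i w : W w -> ell (s_ i *m w) <> ell w.
Proof.
move=> Ww; case: (pos_act Ww (simple_root i)) => [/(ell_up Ww) ->|].
  by move=> /eqP; rewrite gtn_eqF.
by move=> /(ell_down Ww) -> /eqP; rewrite ltn_eqF.
Qed.

(** * Coordinates with respect to the flow-up classes *)

Section FlowupBasis.
Variables (L : seq 'M[R]_n) (Pw : 'M[R]_n -> cls R n).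
Hypotheses (uniqL : uniq L) (memL : forall w, w \in L <-> W w).
Hypothesis PwP : forall w, W w -> is_flowup w (Pw w).

Definition comb (c : 'M[R]_n -> {mpoly R[n]}) : cls R n :=
  fun y => \sum_(w <- L) c w * Pw w y.

Lemma comb_gkm c : gkm Phi a h (comb c).
Proof.
move=> al u w e; rewrite /comb -sumrB big_seq.
elim/big_ind: _ => [||x /memL Wx]; [exact: ldvd0|exact: ldvdD|].
rewrite -mulrBr; apply: ldvdMl; have [Pg _ _ _] := PwP Wx; exact: Pg e.
Qed.

Lemma comb_lin (f g : {mpoly R[n]}) c d y :
  comb (fun w => f * c w + g * d w) y = f * comb c y + g * comb d y.
Proof.
rewrite /comb !mulr_sumr -big_split; apply: eq_bigr => w _ /=.
by rewrite mulrDl !mulrA.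
Qed.

Lemma eq_comb c d : (forall w, W w -> c w = d w) -> comb c = comb d.
Proof.
by move=> cd; apply/funext => y; apply: eq_big_seq => w /memL Ww; rewrite cd.
Qed.

Lemma comb_at c w y : W w -> (forall x, W x -> x <> w -> c x * Pw x y = 0) ->
  comb c y = c w * Pw w y.
Proof.
move=> Ww cw; have w_in : w \in L by apply/memL.
rewrite /comb (bigD1_seq w) //= big_seq_cond big1 ?addr0 // => x /andP [/memL Wx /eqP xw].
exact: cw.
Qed.

Lemma comb_delta w y : W w -> comb (fun x => (x == w)%:R) y = Pw w y.
Proof.
move=> Ww; rewrite (@comb_at _ w) ?eqxx ?mul1r // => x _ /eqP/negbTE ->.
by rewrite mul0r.
Qed.

(** Every point strictly above [x] in the Hessenberg order is strictly longer than [x]. *)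
Lemma Pw_triangular x y : W x -> W y -> y <> x -> (ell y <= ell x)%N -> Pw x y = 0.
Proof.
move=> Wx Wy yx le; apply: contrapT => Py; have [_ _ _ Ps] := PwP Wx.
by case: (Ps y Wy Py) => // /hess_lt_ell; rewrite ltnNge le.
Qed.

Lemma Pw_diag_neq0 w : W w -> Pw w w != 0.
Proof. by move=> /PwP [_ _ -> _]; exact: prod_hinversions_neq0. Qed.

(** Induction on length: at [w] the shorter terms agree by induction, the other terms vanish by
    triangularity, and the diagonal value is a nonzero polynomial. *)
Lemma comb_inj c d : eqW a (comb c) (comb d) -> forall w, W w -> c w = d w.
Proof.
move=> cd w; have [N] := ubnP (ell w); elim: N w => // N IH w wN Ww.
have := cd w Ww; have := comb_lin 1 (-1) c d w.
rewrite !mul1r !mulN1r => + cdw; rewrite cdw subrr (@comb_at _ w) // => [/eqP|x Wx xw].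
  by rewrite mulf_eq0 (negbTE (Pw_diag_neq0 Ww)) orbF mul1r mulN1r subr_eq0 => /eqP.
have [xl|xl] := ltnP (ell x) (ell w).
  by rewrite (IH x) ?mul1r ?mulN1r ?subrr ?mul0r //; exact: leq_trans xl wN.
by rewrite Pw_triangular ?mulr0 //; exact: nesym.
Qed.

(** Length levels are removed from the bottom: at a shortest point of the support all lower
    neighbours vanish, so the value is a multiple of that of the flow-up class there, and this
    multiple is subtracted. *)
Lemma comb_surj P : gkm Phi a h P -> exists c, eqW a P (comb c).
Proof.
(* At most the top [N] length levels may carry nonzero values. Lengths run from 0 to
   [size posroots], so the successor of that size makes the condition vacuous. *)
suff span N Q : gkm Phi a h Q ->
    (forall y, W y -> (ell y + N <= size posroots)%N -> Q y = 0) ->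
    exists c, eqW a Q (comb c).
  move=> Pg; apply: (span (size posroots).+1 P Pg) => y _.
  by rewrite addnS ltnNge leq_addl.
elim: N Q => [|N IH] Q Qg Q0.
  exists (fun=> 0) => y Wy; rewrite Q0 ?addn0 ?ell_le_posroots // /comb big1 // => w _.
  by rewrite mul0r.
(* The shortest length at which [Q] may still be nonzero. *)
pose level y := (ell y + N == size posroots)%N.
have /choice [q qE] : forall y, exists q, W y -> level y -> Q y = q * Pw y y.
  move=> y; have [[Wy ly]|H] := pselect (W y /\ level y); last first.
    by exists 0 => Wy ly; case: H.
  have [|q qE] := gkm_dvd_prod Qg Wy.
    move=> al al_in; have e : hess_edge Phi a h al (refl al *m y) y by apply/hess_edgeP.
    have [Wal _ _ _] := e; apply: Q0 => //.
    rewrite -(eqP ly) addnS -addSn leq_add2r; exact: hess_lt_ell (hess_lt1 e).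
  by exists q => _ _; have [_ _ -> _] := PwP Wy; rewrite mulrC.
pose c y := if level y then q y else 0.
have [||d dE] := IH (fun y => 1 * Q y + (-1) * comb c y).
- by apply: gkm_combine => //; exact: comb_gkm.
- move=> y Wy; rewrite leq_eqVlt => /orP [ly|ly]; rewrite mul1r mulN1r.
    rewrite (@comb_at _ y) // => [|x Wx xy]; first by rewrite /c /level ly (qE y) ?subrr.
    rewrite /c; case: ifP => lx; last by rewrite mul0r.
    rewrite Pw_triangular ?mulr0 //; first exact: nesym.
    by rewrite -(leq_add2r N) (eqP ly) (eqP lx).
  rewrite Q0 ?addnS // sub0r /comb big_seq big1 ?oppr0 // => x /memL Wx.
  rewrite /c; case: ifP => lx; last by rewrite mul0r.
  have xy : (ell y < ell x)%N by rewrite -(ltn_add2r N) (eqP lx).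
  rewrite Pw_triangular ?mulr0 //; last exact: ltnW.
  by move=> yx; rewrite yx ltnn in xy.
exists (fun w => 1 * d w + 1 * c w) => y Wy.
by rewrite comb_lin -dE // !mul1r mulN1r subrK.
Qed.

Lemma coef_exists P : exists c, gkm Phi a h P -> eqW a P (comb c).
Proof.
have [/comb_surj [c cE]|nP] := pselect (gkm Phi a h P); first by exists c.
by exists (fun=> 0).
Qed.

Definition coef P : 'M[R]_n -> {mpoly R[n]} := sval (cid (coef_exists P)).

Lemma coefE P : gkm Phi a h P -> eqW a P (comb (coef P)).
Proof. exact: (svalP (cid (coef_exists P))). Qed.

Lemma coef_unique P c : gkm Phi a h P -> eqW a P (comb c) ->
  forall w, W w -> coef P w = c w.
Proof.
by move=> Pg Pc; apply: comb_inj => y Wy; rewrite -coefE // Pc.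
Qed.

Lemma coef_comb c w : W w -> coef (comb c) w = c w.
Proof. by move=> Ww; apply: coef_unique => //; exact: comb_gkm. Qed.

Lemma eq_coef P Q : gkm Phi a h P -> gkm Phi a h Q -> eqW a P Q ->
  forall w, W w -> coef P w = coef Q w.
Proof.
by move=> Pg Qg PQ; apply: coef_unique => // y Wy; rewrite PQ // coefE.
Qed.

(* The linear map sending [Pw w] to [Pw (s_i w)] if [s_i w < w], and to [0]
   otherwise, written on coordinates. *)
Definition ddiff i P : cls R n :=
  comb (fun v => if (ell v < ell (s_ i *m v))%N then coef P (s_ i *m v) else 0).

Lemma ddiff_hom i : gkm_hom Phi a h (ddiff i).
Proof.
split=> [P Q Pg Qg PQ y Wy|P _|f g P Q Pg Qg y Wy]; last 1 first.
- rewrite /ddiff -comb_lin; congr (_ y); apply: eq_comb => v Wv.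
  case: ifP => _; last by rewrite !mulr0 addr0.
  apply: (@coef_unique _ (fun x => f * coef P x + g * coef Q x)).
  - exact: gkm_combine.
  - by move=> x Wx; rewrite comb_lin -!coefE.
  - exact: inW_simple.
- rewrite /ddiff; congr (_ y); apply: eq_comb => v Wv.
  by case: ifP => // _; apply: eq_coef => //; exact: inW_simple.
exact: comb_gkm.
Qed.

Lemma coef_Pw w x : W w -> W x -> coef (Pw w) x = (x == w)%:R.
Proof.
move=> Ww Wx; apply: (@coef_unique _ (fun x => (x == w)%:R)) => //.
  by have [] := PwP Ww.
by move=> y _; rewrite comb_delta.
Qed.

Lemma ddiff_down i w : W w -> (ell (s_ i *m w) < ell w)%N ->
  eqW a (ddiff i (Pw w)) (Pw (s_ i *m w)).
Proof.
move=> Ww lw y Wy; have Wsw := inW_simple i Ww.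
rewrite -(comb_delta y Wsw); congr (_ y); apply: eq_comb => v Wv.
rewrite coef_Pw //; last exact: inW_simple.
have -> : (v == s_ i *m w) = (s_ i *m v == w).
  by apply/eqP/eqP => [->|<-]; rewrite reflKm ?simple_neq0.
case: eqVneq => [vw|_]; last by rewrite if_same.
by rewrite vw -[X in (ell X < _)%N](reflKm v (simple_neq0 i)) vw lw.
Qed.

(** A nonzero coordinate at [v] needs [s_ i *m v = w] with [v] shorter than [w], so [s_ i] would
    have to lower [w]. *)
Lemma ddiff_up i w : W w -> (ell w < ell (s_ i *m w))%N ->
  eqW a (ddiff i (Pw w)) (fun=> 0).
Proof.
move=> Ww lw y Wy; rewrite /ddiff /comb big_seq big1 // => v /memL Wv.
case: ifP => lv; last by rewrite mul0r.
rewrite coef_Pw //; last exact: inW_simple.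
case: eqVneq => [vw|_]; last by rewrite mul0r.
rewrite vw -[X in (ell X < _)%N](reflKm v (simple_neq0 i)) vw in lv.
by have := ltn_trans lv lw; rewrite ltnn.
Qed.

Lemma comp_ops_gkm s P : gkm Phi a h P -> gkm Phi a h (comp_ops ddiff s P).
Proof. by case: s => //= i s _; exact: comb_gkm. Qed.

(* The coordinates of an iterated operator depend on the word [s] only through
   its product and its size. *)
Lemma coef_comp_ops s P v : gkm Phi a h P -> W v ->
  coef (comp_ops ddiff s P) v =
  if (ell ((word_mx a s)^T *m v) == ell v + size s)%N
  then coef P ((word_mx a s)^T *m v) else 0.
Proof.
move=> Pg; elim: s v => [|i s IH] v Wv.
  by rewrite /= trmx1 mul1mx addn0 eqxx.
have Wsv := inW_simple i Wv.
rewrite /= coef_comb // IH // trmx_mul refl_tr -mulmxA.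
case: ltnP => lv.
  by rewrite (ell_up Wv) ?addSnnS //; apply/(ell_ltP i Wv).
have {}lv : (ell (s_ i *m v) < ell v)%N.
  by rewrite ltn_neqAle lv andbT; apply/eqP; exact: ell_simple_neq.
(* If [s_ i] lowers [v], the remaining word adds at most [size s] to the length, so the required
   length is out of reach. *)
case: eqP => // lE; have := ell_word_le s Wsv.
by rewrite lE addnS -addSn leq_add2r leqNgt ltnS ltnW.
Qed.

(** Two reduced words of [w] have the same product and, by minimality of both, the same size, so all
    coordinates of the two results agree. *)
Lemma comp_ops_eq w s t : reduced_word a s w -> reduced_word a t w ->
  forall P, gkm Phi a h P -> eqW a (comp_ops ddiff s P) (comp_ops ddiff t P).
Proof.
move=> [ws smin] [wt tmin] P Pg y Wy.
have st : size s = size t by apply/eqP; rewrite eqn_leq smin ?tmin.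
rewrite (coefE (comp_ops_gkm s Pg)) // (coefE (comp_ops_gkm t Pg)) //.
by congr (_ y); apply: eq_comb => v Wv; rewrite !coef_comp_ops // -ws -wt st.
Qed.

End FlowupBasis.

End HighestRoot.

Theorem theorem3p3 (R : realType) (n k : nat) (Phi : seq 'cV[R]_n)
    (a : 'I_k -> 'cV[R]_n) (gamma : 'cV[R]_n) :
  root_system Phi -> base Phi a -> irreducible Phi ->
  highest_root Phi a gamma ->
  let h := h_gamma Phi a gamma in
  exists (D : 'I_k -> cls R n -> cls R n) (Pw : 'M[R]_n -> cls R n),
    [/\ (forall i, gkm_hom Phi a h (D i)),
        (forall w, inW a w -> flowup Phi a h w (Pw w)),
        (forall w i, inW a w ->
           (bruhat_lt Phi a (refl (a i) *m w) w ->
              eqW a (D i (Pw w)) (Pw (refl (a i) *m w))) /\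
           (bruhat_lt Phi a w (refl (a i) *m w) ->
              eqW a (D i (Pw w)) (fun _ => 0))) &
        (forall w s t, reduced_word a s w -> reduced_word a t w ->
           forall P, gkm Phi a h P -> eqW a (comp_ops D s P) (comp_ops D t P))].
Proof.
move=> rootsP baseP _ highP h.
have [L [uniqL memL]] := inW_finite rootsP baseP.
(* Off [W] the family takes the zero class as a default. *)
have /choice [Pw PwP] : forall w, exists P, inW a w -> is_flowup Phi a gamma w P.
  move=> w; have [Ww|nWw] := pselect (inW a w); last by exists (fun=> 0).
  by have [P PP] := flowup_exists rootsP baseP highP Ww; exists P.
exists (ddiff rootsP baseP uniqL memL PwP), Pw; split.
- by move=> i; exact: ddiff_hom.
- by move=> w Ww; apply: (is_flowupP rootsP baseP) => //; exact: PwP.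
(* The Bruhat comparison is turned into one of lengths, on which [ddiff] is defined. *)
- move=> w i Ww; split=> /(bruhat_lt_ell rootsP baseP) lw; first exact: ddiff_down.
  exact: ddiff_up.
exact: comp_ops_eq.
Qed.
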